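(* Let $X\in\mathbb{R}^{n\times n}$ and let $k$ be a fixed integer with $0<k\le\mathrm{rank}(X)$. Let $X_k^*\in\mathbb{R}^{n\times k}$ be a column submatrix of $X$ that maximizes $\log\mathrm{vol}(B)$ among all column submatrices $B\in\mathbb{R}^{n\times k}$ of $X$. Define the perturbation $Z\equiv X+\epsilon G$, where $\epsilon>0$ and $G\in\mathbb{R}^{n\times n}$ is a standard Gaussian random matrix. Let $Z_k=Z_{\mathcal{S}_k}$ be the output of the Businger–Golub QR column selection algorithm applied to $Z$, and let $X_k=X_{\mathcal{S}_k}$ be the corresponding columns of $X$. Let $0<\delta<1$ and define $$\Delta_1\equiv\frac{\delta\epsilon}{4.7\sqrt n},\qquad \Delta_2\equiv 2\sqrt n+\sqrt{2\log(4/\delta)}.$$ If $$0<\epsilon<\min\left\{\frac{\sigma_k(X_k^* )}{2\Delta_2},\ \frac{\sigma_k(X)}{\Delta_2\bigl(1+2^{k+1}\sqrt{n-k}\bigr)}\right\},$$ then, with probability at least $1-\delta$, $$0\le\log\mathrm{vol}(X_k^* )-\log\mathrm{vol}(X_k)\le\frac1e\log\mathrm{vol}(X_k^*/\Delta_1)+k(2\eta_2+\eta_1),$$ where $\eta_1\equiv\epsilon\Delta_2/\sigma_k(Z_k)\le 1/2$ and $\eta_2\equiv\epsilon\Delta_2/\sigma_k(X_k^* )\le 1/2$.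
   Context: $\sigma_1\ge\sigma_2\ge\cdots$ denote singular values in non-increasing order. A standard Gaussian random matrix has independent Gaussian entries with mean zero and variance $1$. For $\mathcal{S}\subset\{1,\ldots,n\}$, $X_{\mathcal{S}}$ is the submatrix of $X$ consisting of the columns indexed by $\mathcal{S}$. $\mathrm{vol}(B)=\sqrt{\det(B^TB)}$, the product of the singular values when $B$ has full column rank (and $0$ when columns are linearly dependent). $\log$ is the natural logarithm. Businger–Golub QR column selection (QR with column pivoting). Input: $Z\in\mathbb{R}^{n\times n}$ with columns $z_1,\ldots,z_n$, and an integer $0<k\le\mathrm{rank}(Z)$. Set $P_0=0\in\mathbb{R}^{n\times n}$, $\mathcal{S}_0=\emptyset$, $\mathcal{T}_0=\{1,\ldots,n\}$. For $j=1,\ldots,k$: select $t\in\mathcal{T}_{j-1}$ with $\|(I-P_{j-1})z_t\|=\max_{i\in\mathcal{T}_{j-1}}\|(I-P_{j-1})z_i\|$ (Euclidean norm); set $\mathcal{S}_j=\mathcal{S}_{j-1}\cup\{t\}$, $\mathcal{T}_j=\mathcal{T}_{j-1}-\{t\}$, $y_j=(I-P_{j-1})z_t$, and $P_j=P_{j-1}+y_jy_j^\dagger$ with $y_j^\dagger=y_j^T/\|y_j\|^2$. Output: the column submatrix $Z_{\mathcal{S}_k}$.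
   Formalization: The bound η₁ ≤ 1/2 is asserted only for k < n; for k = n it can fail (n = k = 1, X = (x) with x slightly above 2εΔ₂, small δ), while the two-sided inequality and η₂ ≤ 1/2 are stated for all 0 < k ≤ rank(X). *)

(* Defs.v *)
From HB Require Import structures.
From mathcomp Require Import all_boot all_order all_algebra spectral.
From mathcomp Require Import complex.
From mathcomp Require Import all_classical all_reals all_analysis.
Set Implicit Arguments.
Unset Strict Implicit.
Unset Printing Implicit Defensive.
Import Order.TTheory GRing.Theory Num.Theory.
Local Open Scope classical_set_scope.
Local Open Scope ring_scope.

(* The eigenvalues of B^T B, counted with multiplicity, are the squares of the
   entries of s.  For B of size m x p this lists p values; when m < p the ones
   beyond the m-th are 0. *)
Definition is_singular_values (R : realType) m p (B : 'M[R]_(m, p))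
    (s : seq R) : Prop :=
  [/\ sorted >=%R s, all (fun x => 0 <= x) s &
      char_poly (B^T *m B) = \prod_(x <- s) ('X - (x ^+ 2)%:P)].

(* Well defined: see singular_valuesP and is_singular_values_inj below. *)
Definition singular_values (R : realType) m p (B : 'M[R]_(m, p)) : seq R :=
  xget [::] [set s | is_singular_values B s].

Lemma is_singular_values_inj (R : realType) m p (B : 'M[R]_(m, p)) s s' :
  is_singular_values B s -> is_singular_values B s' -> s = s'.
Proof.
move=> [ss s0 es] [ss' s0' es'].
have pe : perm_eq [seq x ^+ 2 | x <- s] [seq x ^+ 2 | x <- s'].
  by apply: prod_XsubC_eq; rewrite !big_map -es -es'.
have sqK r : all (fun x : R => 0 <= x) r ->
    map Num.sqrt [seq x ^+ 2 | x <- r] = r.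
  move=> /allP r0; rewrite -map_comp -[RHS]map_id; apply/eq_in_map => x xr /=.
  by rewrite sqrtr_sqr ger0_norm// r0.
apply: (sorted_eq (leT := >=%R)) ss ss' _.
- by move=> y x z xy yz; exact: le_trans yz xy.
- by move=> x y; rewrite andbC => /le_anti.
- by rewrite -(sqK s)// -(sqK s')//; exact: perm_map.
Qed.

Lemma char_poly_conj (F : fieldType) n (Q A : 'M[F]_n) : Q \in unitmx ->
  char_poly (invmx Q *m A *m Q) = char_poly A.
Proof.
move=> Qu; rewrite /char_poly.
have -> : char_poly_mx (invmx Q *m A *m Q) =
    map_mx polyC (invmx Q) *m char_poly_mx A *m map_mx polyC Q.
  rewrite /char_poly_mx mulmxBr mulmxBl -!map_mxM; congr (_ - _).
  by rewrite mul_mx_scalar -scalemxAl -map_mxM mulVmx// map_mx1 scalemx1.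
rewrite !det_mulmx mulrAC -det_mulmx -map_mxM mulVmx//.
by rewrite map_mx1 det1 mul1r.
Qed.

Lemma char_poly_gram_split (R : realType) m p (B : 'M[R]_(m, p)) :
  exists r : seq R, char_poly (B^T *m B) = \prod_(x <- r) ('X - x%:P).
Proof.
set A := B^T *m B; pose f := real_complex R.
pose AC : 'M[R[i]]_p := map_mx f A.
have Asym : AC \is symmetricmx.
  apply/is_hermitianmxP; rewrite expr0 scale1r map_mx_id//.
  by rewrite /AC map_trmx /A trmx_mul trmxK.
have Areal : AC \is a realmx.
  by apply/mxOverP => i j; rewrite mxE /=; by apply/complex_realP; exists (A i j).
have Aherm := realsym_hermsym Asym Areal.
have /hermitian_normalmx /orthomx_spectralP AE := Aherm.
have /mxOverP dreal := hermitian_spectral_diag_real Aherm.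
exists [seq complex.Re (spectral_diag AC 0 i) | i <- index_enum 'I_p].
apply: (map_poly_inj f); rewrite map_char_poly -/AC [in LHS]AE char_poly_conj ?spectral_unit//.
rewrite char_poly_trig ?diag_mx_is_trig// big_map rmorph_prod/=.
apply: eq_bigr => i _; rewrite rmorphB/= map_polyX map_polyC/= mxE eqxx mulr1n.
by rewrite (RRe_real (dreal ord0 i)).
Qed.

Lemma singular_valuesP (R : realType) m p (B : 'M[R]_(m, p)) :
  is_singular_values B (singular_values B).
Proof.
have [r rE] := char_poly_gram_split B.
have r_ge0 x : x \in r -> 0 <= x.
  move=> xr; have : eigenvalue (B^T *m B) x.
    by rewrite eigenvalue_root_char rE root_prod_XsubC.
  case/eigenvalueP => v vE v0.
  have n_ge0 q (u : 'rV[R]_q) : 0 <= (u *m u^T) 0 0.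
    by rewrite mxE sumr_ge0// => i _; rewrite mxE -expr2 sqr_ge0.
  have n_gt0 : 0 < (v *m v^T) 0 0.
    rewrite lt_neqAle n_ge0 andbT eq_sym; apply: contra v0 => /eqP v20.
    apply/eqP/rowP => i; rewrite mxE; apply/eqP; rewrite -sqrf_eq0; apply/eqP.
    move: v20; rewrite mxE => /eqP; rewrite psumr_eq0; last first.
      by move=> j _; rewrite mxE -expr2 sqr_ge0.
    by move=> /allP/(_ i (mem_index_enum _))/eqP; rewrite mxE -expr2.
  have := n_ge0 _ (v *m B^T); rewrite trmx_mul trmxK mulmxA -(mulmxA v) vE.
  by rewrite -scalemxAl mxE pmulr_lge0.
rewrite /singular_values; apply: (@xgetPex _ [::] [set s | is_singular_values B s]).
exists (sort >=%R (map Num.sqrt r)); split => /=.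
- by apply: sort_sorted => x y; exact: le_total.
- rewrite all_sort; apply/allP => _ /mapP[x _ ->]; exact: sqrtr_ge0.
- rewrite rE (perm_big _ (permEl (perm_sort _ _)))/= big_map.
  by rewrite !big_seq; apply: eq_bigr => x /r_ge0 x0; rewrite sqr_sqrtr.
Qed.

(* Indexed from 1, so that sigma 1 B is the largest singular value. *)
Definition sigma (R : realType) (j : nat) m p (B : 'M[R]_(m, p)) : R :=
  (singular_values B)`_j.-1.

Definition vol (R : realType) m p (B : 'M[R]_(m, p)) : R :=
  Num.sqrt (\det (B^T *m B)).

(* Extended-real valued, since lne 0 = -oo whereas the real-valued ln is 0
   at 0. *)
Definition log_vol (R : realType) m p (B : 'M[R]_(m, p)) : \bar R :=
  lne (vol B)%:E.

Definition col_submx (R : realType) m n (X : 'M[R]_(m, n)) (S : {set 'I_n}) :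
    'M[R]_(m, #|S|) :=
  colsub (@enum_val _ (mem S)) X.

Definition maximizes_log_vol (R : realType) n (X : 'M[R]_n) (k : nat)
    (S : {set 'I_n}) : Prop :=
  #|S| = k /\
  forall S' : {set 'I_n}, #|S'| = k ->
    (log_vol (col_submx X S') <= log_vol (col_submx X S))%E.

(* The norm `|v| that MathComp-Analysis puts on matrices is the sup norm. *)
Definition norm2 (R : realType) m (v : 'cV[R]_m) : R :=
  Num.sqrt (\sum_i v i 0 ^+ 2).

(* bg_state Z j S T P: some run of j steps of column pivoting on Z, with
   arbitrary tie-breaking, reaches S_j = S, T_j = T and P_j = P. *)
Inductive bg_state (R : realType) n (Z : 'M[R]_n) :
    nat -> {set 'I_n} -> {set 'I_n} -> 'M[R]_n -> Prop :=
| bg_init : bg_state Z 0 finset.set0 [set: 'I_n]%SET 0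
| bg_step j S T P t :
    bg_state Z j S T P ->
    t \in T ->
    (forall i, i \in T ->
       norm2 ((1%:M - P) *m col i Z) <= norm2 ((1%:M - P) *m col t Z)) ->
    let y := (1%:M - P) *m col t Z in
    bg_state Z j.+1 (t |: S)%SET (T :\ t)%SET
      (P + y *m ((norm2 y ^+ 2)^-1 *: y^T)).

Definition bg_output (R : realType) n (Z : 'M[R]_n) (k : nat)
    (S : {set 'I_n}) : Prop :=
  exists T P, bg_state Z k S T P.

Section gaussian.
Local Open Scope ereal_scope.

Definition mutually_independent (d : measure_display) (Omega : measurableType d)
    (R : realType) (P : probability Omega R) (I : finType)
    (X : I -> {RV P >-> R}) : Prop :=
  forall (J : {set I}) (A : I -> set R), (forall i, measurable (A i)) ->
    P (\bigcap_(i in [set i | i \in J]) X i @^-1` A i) =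
    \prod_(i in J) P (X i @^-1` A i).

Definition standard_gaussian_mx (d : measure_display) (Omega : measurableType d)
    (R : realType) (P : probability Omega R) (m n : nat)
    (G : 'I_m -> 'I_n -> {RV P >-> R}) : Prop :=
  mutually_independent (fun ij : 'I_m * 'I_n => G ij.1 ij.2) /\
  forall i j (A : set R), measurable A ->
    distribution P (G i j) A = normal_prob 0%R 1%R A.

End gaussian.

Definition rv_mx (d : measure_display) (Omega : measurableType d)
    (R : realType) (P : probability Omega R) (m n : nat)
    (G : 'I_m -> 'I_n -> {RV P >-> R}) (w : Omega) : 'M[R]_(m, n) :=
  \matrix_(i, j) G i j w.

(* Main.v *)
Require Import Defs.
From HB Require Import structures.
From mathcomp Require Import all_boot all_order all_algebra perm.
From mathcomp Require Import all_classical all_reals all_analysis measurable_realfun.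
From mathcomp Require Import ring lra zify.
Set Implicit Arguments.
Unset Strict Implicit.
Unset Printing Implicit Defensive.
Import Order.TTheory GRing.Theory Num.Theory.
Local Open Scope classical_set_scope.
Local Open Scope ring_scope.

(** Write D for eps * Delta2, G for the Gaussian matrix and E = eps G.

    Randomness enters through one event only: the operator norm of G is at most
    (8/5) Delta2, and at most (13/10) Delta2 if n <= 4.  To bound x^T G y for
    all unit vectors at once, both vectors are rounded to the lattice of
    spacing 1 / sqrt n.  For lattice points the form is Gaussian with variance
    |x|^2 |y|^2, and each pair of points is allowed a failure probability
    proportional to exp (- n |x|^2 / 2 - n |y|^2 / 2); over the lattice these
    sum to a controlled quantity.  Against a quadratic penalty each coordinate
    may be rounded separately in the better direction, so rounding only adds
    n / 4 to a squared norm equal to n.  This is gaussian_operator_norm; it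
    rests on the product formula for independent variables, proved from the
    product rule for events in integral_prod_indep.

    On that event the rest is deterministic.  Let r_1 >= ... >= r_k be the
    norms of the residuals selected by pivoting on Z = X + E.  The record
    pivoting collects what a run guarantees, and the following consequences are
    used.
    - The selected columns of Z have volume r_1 ... r_k (pivoting_vol).
    - By Courant-Fischer, sigma_k (X) <= sqrt (n - k + 1) r_k + |E|, and
      sigma_j (Xopt) <= sqrt k r_j + |E| for all j
      (singular_value_le_pivot, singular_value_sel_le_pivot).
    - The least singular value of the selected columns is at least
      sqrt 3 * r_k / 2^k (norm2_selected_ge).
    For k < n the first bound and the hypothesis on sigma_k (X) make r_k at
    least of order 2^k D; the third bound then gives sigma_k (Z_S) >= (7/3) D,
    whence eta1 <= 1/2, and passing from Z_S back to X_S costs at most a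
    constant factor per column (selected_well_conditioned, selected_vol_ge).

    It remains to compare volumes.  The second bound and the previous remark
    give vol Xopt <= q^k vol X_S with q = 4 sqrt k if k > 1, and q at most 5 if
    k = 1 (vol_ratio_large, vol_ratio1).  Pivoting on X itself shows that
    (vol Xopt)^(1/k) is at least a constant times 2^k D (max_vol_ge), which is
    so much larger than Delta1 that q^3 Delta1 is still below it.  As e <= 3,
    the loss k ln q is at most (1/e) ln (vol Xopt / Delta1^k); this is
    log_ratio_le.  The terms in eta1 and eta2 are nonnegative. *)

(** * Inner product and Euclidean norm of column vectors *)

Section Euclidean.
Variable R : realType.
Implicit Types m n p : nat.

Definition dot m (u v : 'cV[R]_m) : R := (u^T *m v) 0 0.

Lemma dotE m (u v : 'cV[R]_m) : dot u v = \sum_i u i 0 * v i 0.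
Proof. by rewrite /dot mxE; apply: eq_bigr => i _; rewrite mxE. Qed.

Lemma dotC m (u v : 'cV[R]_m) : dot u v = dot v u.
Proof. by rewrite !dotE; apply: eq_bigr => i _; rewrite mulrC. Qed.

Lemma dotDl m (u v w : 'cV[R]_m) : dot (u + v) w = dot u w + dot v w.
Proof. by rewrite /dot linearD mulmxDl mxE. Qed.

Lemma dotDr m (u v w : 'cV[R]_m) : dot w (u + v) = dot w u + dot w v.
Proof. by rewrite dotC dotDl !(dotC w). Qed.

Lemma dotZl m a (u v : 'cV[R]_m) : dot (a *: u) v = a * dot u v.
Proof. by rewrite /dot linearZ/= -scalemxAl mxE. Qed.

Lemma dotZr m a (u v : 'cV[R]_m) : dot u (a *: v) = a * dot u v.
Proof. by rewrite dotC dotZl dotC. Qed.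

Lemma dotNr m (u v : 'cV[R]_m) : dot u (- v) = - dot u v.
Proof. by rewrite -scaleN1r dotZr mulN1r. Qed.

Lemma dotv0 m (u : 'cV[R]_m) : dot u 0 = 0.
Proof. by rewrite /dot mulmx0 mxE. Qed.

Lemma dot0v m (u : 'cV[R]_m) : dot 0 u = 0.
Proof. by rewrite dotC dotv0. Qed.

Lemma dot_mulmx m n (A : 'M[R]_(m, n)) u v :
  dot u (A *m v) = dot (A^T *m u) v.
Proof. by rewrite /dot trmx_mul trmxK mulmxA. Qed.

Lemma dotvv_ge0 m (u : 'cV[R]_m) : 0 <= dot u u.
Proof. by rewrite dotE sumr_ge0// => i _; rewrite -expr2 sqr_ge0. Qed.

Lemma norm2_sqr m (u : 'cV[R]_m) : norm2 u ^+ 2 = dot u u.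
Proof.
rewrite /norm2 sqr_sqrtr; last by rewrite sumr_ge0// => i _; rewrite sqr_ge0.
by rewrite dotE; apply: eq_bigr => i _; rewrite expr2.
Qed.

Lemma norm2_ge0 m (u : 'cV[R]_m) : 0 <= norm2 u.
Proof. exact: sqrtr_ge0. Qed.

Lemma norm2_sum_sqr m (u : 'cV[R]_m) : norm2 u ^+ 2 = \sum_i u i 0 ^+ 2.
Proof. by rewrite norm2_sqr dotE; apply: eq_bigr => i _; rewrite expr2. Qed.

Lemma norm2_eq0 m (u : 'cV[R]_m) : (norm2 u == 0) = (u == 0).
Proof.
apply/idP/idP => [|/eqP->]; last first.
  by rewrite -sqrf_eq0 norm2_sqr /dot mulmx0 mxE.
rewrite -sqrf_eq0 norm2_sum_sqr psumr_eq0; last by move=> i _; rewrite sqr_ge0.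
move=> /allP u0; apply/eqP/colP => i; rewrite mxE; apply/eqP.
by rewrite -sqrf_eq0; apply: u0; rewrite mem_index_enum.
Qed.

Lemma norm20 m : norm2 (0 : 'cV[R]_m) = 0.
Proof. by apply/eqP; rewrite norm2_eq0. Qed.

Lemma norm2_gt0 m (u : 'cV[R]_m) : (0 < norm2 u) = (u != 0).
Proof. by rewrite lt_neqAle norm2_ge0 andbT eq_sym norm2_eq0. Qed.

Lemma dot_le_norm2 m (u v : 'cV[R]_m) : `|dot u v| <= norm2 u * norm2 v.
Proof.
rewrite -(@ler_pXn2r _ 2) ?nnegrE ?mulr_ge0 ?norm2_ge0//.
rewrite exprMn !norm2_sqr real_normK ?num_real//.
have [u0|u0] := eqVneq (dot u u) 0.
  have /eqP -> : u == 0 by rewrite -norm2_eq0 -sqrf_eq0 norm2_sqr u0.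
  by rewrite /dot trmx0 !mul0mx mxE expr0n/= mul0r.
have u_gt0 : 0 < dot u u by rewrite lt_neqAle eq_sym u0 dotvv_ge0.
have := dotvv_ge0 (dot u u *: v - dot u v *: u).
rewrite !(dotDl, dotDr) -scaleN1r !(dotZl, dotZr) (dotC v u) => h.
rewrite -subr_ge0 -(pmulr_rge0 _ u_gt0); apply: le_trans h _.
by rewrite le_eqVlt; apply/orP; left; apply/eqP; ring.
Qed.

Lemma norm2D m (u v : 'cV[R]_m) : norm2 (u + v) <= norm2 u + norm2 v.
Proof.
rewrite -(@ler_pXn2r _ 2) ?nnegrE ?addr_ge0 ?norm2_ge0//.
rewrite sqrrD !norm2_sqr !(dotDl, dotDr) (dotC v u).
by have := le_trans (ler_norm _) (dot_le_norm2 u v); lra.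
Qed.

Lemma norm2Z m a (u : 'cV[R]_m) : norm2 (a *: u) = `|a| * norm2 u.
Proof.
apply/eqP; rewrite -(@eqrXn2 _ 2) ?mulr_ge0 ?norm2_ge0//.
by rewrite exprMn !norm2_sqr dotZl dotZr real_normK ?num_real// mulrA expr2.
Qed.

Lemma norm2N m (u : 'cV[R]_m) : norm2 (- u) = norm2 u.
Proof. by rewrite -scaleN1r norm2Z normrN1 mul1r. Qed.

Lemma norm2_sum m (I : finType) (F : I -> 'cV[R]_m) :
  norm2 (\sum_i F i) <= \sum_i norm2 (F i).
Proof.
elim/big_ind2: _ => [|x1 x2 y1 y2 h1 h2|//]; first by rewrite norm20.
exact: le_trans (norm2D _ _) (lerD h1 h2).
Qed.

Lemma norm2_orth n (Q : 'M[R]_n) x : Q^T *m Q = 1%:M ->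
  norm2 (Q *m x) = norm2 x.
Proof.
move=> QQ; apply/eqP; rewrite -(@eqrXn2 _ 2) ?norm2_ge0//.
by rewrite !norm2_sqr dot_mulmx mulmxA QQ mul1mx.
Qed.

End Euclidean.

(** * Orthonormal diagonalisation of Gram matrices *)

Section Spectral.
Variable R : realType.

(** The Householder reflection that exchanges u and the first basis vector. *)
Lemma orth_first_col p (u : 'cV[R]_(1 + p)) : dot u u = 1 ->
  exists H : 'M[R]_(1 + p), H^T *m H = 1%:M /\ H *m delta_mx 0 0 = u.
Proof.
move=> u1; pose e : 'cV[R]_(1 + p) := delta_mx 0 0.
have e1 : dot e e = 1.
  rewrite dotE (bigD1 0)//= big1 ?addr0 ?mxE ?eqxx ?mulr1//.
  by move=> i /negbTE i0; rewrite mxE i0 mul0r.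
have [ue|ue] := eqVneq u e.
  by exists 1%:M; rewrite trmx1 mulmx1 mul1mx ue.
pose w := u - e; pose c := 2 / dot w w.
have w0 : dot w w != 0 by rewrite -norm2_sqr sqrf_eq0 norm2_eq0 subr_eq0.
have ww : w^T *m w = (dot w w)%:M by rewrite [LHS]mx11_scalar.
have ccw : c ^+ 2 * dot w w = 2 * c by rewrite /c; field.
exists (1%:M - c *: (w *m w^T)); split.
  have -> : (1%:M - c *: (w *m w^T))^T = 1%:M - c *: (w *m w^T).
    by rewrite raddfB/= linearZ/= trmx1 trmx_mul trmxK.
  rewrite mulmxBl mul1mx mulmxBr mulmx1 -scalemxAl -scalemxAr.
  have -> : w *m w^T *m (w *m w^T) = dot w w *: (w *m w^T).
    by rewrite mulmxA -(mulmxA w) ww mul_mx_scalar -scalemxAl.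
  rewrite !scalerA -expr2 ccw; move: (w *m w^T) => M.
  by apply/matrixP => i j; rewrite !mxE; ring.
rewrite mulmxBl mul1mx -scalemxAl -mulmxA.
have -> : w^T *m delta_mx 0 0 = (dot w e)%:M by rewrite [LHS]mx11_scalar.
rewrite mul_mx_scalar scalerA.
have -> : c * dot w e = -1.
  have -> : dot w e = - (dot w w) / 2.
    have dNl (x y : 'cV[R]_(1 + p)) : dot (- x) y = - dot x y.
      by rewrite dotC dotNr dotC.
    by rewrite /w !(dotDl, dotDr) !(dNl, dotNr) (dotC e u) u1 e1; field.
  by rewrite /c; field.
by rewrite scaleN1r opprK addrC subrK.
Qed.

(** Deflation on B itself, so that the smaller problem is again a Gram matrix:
    a reflection moves a unit eigenvector of B^T B to the first position, which
    makes the first column of the rotated B orthogonal to the others. *)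
Lemma gram_orth_diag p m (B : 'M[R]_(m, p)) : exists Q : 'M[R]_p,
  Q^T *m Q = 1%:M /\ is_diag_mx ((B *m Q)^T *m (B *m Q)).
Proof.
elim: p m B => [|p IH] m B.
  by exists 1%:M; rewrite trmx1 mulmx1; split => //; apply/is_diag_mxP => -[].
have [r rE] := char_poly_gram_split B.
have [l lr] : exists l, l \in r.
  have := size_char_poly (B^T *m B); rewrite rE size_prod_XsubC.
  by case: r {rE} => // l r _; exists l; rewrite mem_head.
have : eigenvalue (B^T *m B) l.
  by rewrite eigenvalue_root_char rE root_prod_XsubC.
case/eigenvalueP => v vE v0.
pose u : 'cV[R]_p.+1 := (norm2 v^T)^-1 *: v^T.
have nv0 : norm2 v^T != 0.
  by rewrite norm2_eq0; apply: contra v0 => /eqP/(congr1 trmx); rewrite trmxK trmx0 => ->.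
have u1 : dot u u = 1.
  by rewrite dotZl dotZr -norm2_sqr; field.
have Au : B^T *m B *m u = l *: u.
  rewrite /u -!scalemxAr scalerA mulrC -scalerA; congr (_ *: _).
  by apply: trmx_inj; rewrite !trmx_mul !trmxK vE linearZ/= trmxK.
have [H [HH He]] := @orth_first_col p u u1.
pose b := lsubmx (B *m H : 'M[R]_(m, 1 + p)); pose B' := rsubmx (B *m H : 'M[R]_(m, 1 + p)).
have bB : B *m H = row_mx b B' by rewrite hsubmxK.
have bE : b = B *m u.
  rewrite -He mulmxA bB.
  have -> : delta_mx 0 0 = col_mx 1%:M 0 :> 'cV[R]_(1 + p).
    apply/colP => i; rewrite !mxE eqxx andbT.
    by case: splitP => j ij; rewrite mxE -val_eqE/= ij ?ord1.
  by rewrite mul_row_col mulmx1 mulmx0 addr0.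
have B'b : B'^T *m b = 0.
  have : H^T *m (B^T *m B *m u) = l *: delta_mx 0 0.
    by rewrite Au -scalemxAr -He mulmxA HH mul1mx.
  rewrite -mulmxA -bE mulmxA -trmx_mul bB tr_row_mx mul_col_mx.
  move=> /(congr1 dsubmx); rewrite col_mxKd => ->.
  by apply/colP => i; rewrite !mxE -val_eqE mulr0.
have [Q' [QQ' diagQ']] := IH _ B'.
pose K : 'M[R]_(1 + p) := block_mx 1%:M 0 0 Q'.
have KK : K^T *m K = 1%:M.
  rewrite tr_block_mx mulmx_block !trmx0 trmx1 !(mul0mx, mulmx0, mul1mx).
  by rewrite !addr0 !add0r QQ' -scalar_mx_block.
exists (H *m K); split.
  by rewrite trmx_mul mulmxA -(mulmxA K^T) HH mulmx1 KK.
rewrite (mulmxA B H K) bB mul_row_block !mulmx0 mulmx1 addr0 add0r.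
set C := row_mx b (B' *m Q').
suff : is_diag_mx (C^T *m C : 'M[R]_(1 + p)) by [].
rewrite /C tr_row_mx mul_col_row.
have -> : (B' *m Q')^T *m b = 0 by rewrite trmx_mul -mulmxA B'b mulmx0.
have -> : b^T *m (B' *m Q') = 0.
  by apply: trmx_inj; rewrite trmx_mul trmxK trmx_mul -mulmxA B'b mulmx0 trmx0.
by rewrite (@is_diag_block_mx _ 1 p 1 p)// !eqxx diagQ' !andbT;
  apply/is_diag_mxP => i j; rewrite !ord1 eqxx.
Qed.
End Spectral.

(** * Singular values and volume *)

Section SingularValues.
Variable R : realType.
Implicit Types m p q : nat.

Lemma size_singular_values m p (B : 'M[R]_(m, p)) :
  size (singular_values B) = p.
Proof.
have [_ _ e] := singular_valuesP B.
by have := size_char_poly (B^T *m B); rewrite e size_prod_XsubC => -[].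
Qed.

Lemma singular_values_ge0 m p (B : 'M[R]_(m, p)) i :
  0 <= (singular_values B)`_i.
Proof.
have [_ /allP s0 _] := singular_valuesP B.
have [ip|ip] := ltnP i (size (singular_values B)); first by apply: s0; exact: mem_nth.
by rewrite nth_default.
Qed.

Lemma singular_values_homo m p (B : 'M[R]_(m, p)) i j : (i <= j)%N ->
  (singular_values B)`_j <= (singular_values B)`_i.
Proof.
move=> ij; have [jp|jp] := ltnP j (size (singular_values B)); last first.
  by rewrite nth_default// singular_values_ge0.
have [ss _ _] := singular_valuesP B.
apply: (sorted_leq_nth _ _ 0 ss) => //.
- by move=> y x z xy yz; exact: le_trans yz xy.
- by move=> x; exact: lexx.
- by rewrite inE; exact: leq_ltn_trans ij jp.
Qed.

Lemma gram_eigenbasis m p (B : 'M[R]_(m, p)) :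
  exists (Q : 'M[R]_p) (d : 'I_p -> R),
  [/\ Q^T *m Q = 1%:M, (B *m Q)^T *m (B *m Q) = diag_mx (\row_i d i),
      forall y, norm2 (B *m (Q *m y)) ^+ 2 = \sum_i d i * y i 0 ^+ 2 &
      perm_eq [seq d i | i <- index_enum 'I_p]
              [seq s ^+ 2 | s <- singular_values B]].
Proof.
have [Q [QQ /is_diag_mxP dg]] := gram_orth_diag B.
set D := (B *m Q)^T *m _ in dg.
exists Q, (fun i => D i i).
have DE : D = diag_mx (\row_i D i i).
  apply/matrixP => i j; rewrite [RHS]mxE [X in _ = X *+ _]mxE.
  have [->|ij] := eqVneq i j.
    by rewrite mulr1n.
  by rewrite mulr0n dg.
split => //.
- move=> y; rewrite mulmxA norm2_sqr dot_mulmx mulmxA -/D DE dotE.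
  apply: eq_bigr => i _.
  rewrite mxE (bigD1 i)//= big1 ?addr0 => [|j ji]; last first.
    by rewrite !mxE eq_sym (negbTE ji) mulr0n mul0r.
  by rewrite !mxE eqxx mulr1n expr2 mulrA.
- apply: prod_XsubC_eq; rewrite !big_map.
  have [_ _ <-] := singular_valuesP B.
  have /mulmx1_unit[QTu Qu] := QQ.
  have QV : invmx Q = Q^T by rewrite -[RHS]mulmx1 -(mulmxV Qu) mulmxA QQ mul1mx.
  rewrite -(@char_poly_conj _ _ Q)// QV.
  have -> : Q^T *m (B^T *m B) *m Q = D by rewrite /D trmx_mul !mulmxA.
  rewrite DE char_poly_trig ?diag_mx_is_trig//.
Qed.

Lemma norm2_ge_singular_value_last m p (B : 'M[R]_(m, p)) x :
  (singular_values B)`_p.-1 * norm2 x <= norm2 (B *m x).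
Proof.
have [Q [d [QQ _ nB pe]]] := gram_eigenbasis B.
have QQ' : Q *m Q^T = 1%:M by exact: mulmx1C.
rewrite -[x]mul1mx -QQ' -mulmxA; set y := Q^T *m x.
rewrite norm2_orth//.
rewrite -(@ler_pXn2r _ 2) ?nnegrE ?mulr_ge0 ?norm2_ge0 ?singular_values_ge0//.
rewrite nB exprMn norm2_sum_sqr mulr_sumr ler_sum// => i _.
rewrite ler_wpM2r ?sqr_ge0//.
have : d i \in [seq s ^+ 2 | s <- singular_values B].
  by rewrite -(perm_mem pe); apply: map_f; rewrite mem_index_enum.
case/(nthP 0) => j; rewrite size_map => jp; rewrite (nth_map 0)// => <-.
rewrite ler_pXn2r ?nnegrE ?singular_values_ge0//.
apply: singular_values_homo; move: jp; rewrite size_singular_values.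
by case: p {B x Q d QQ nB pe QQ' y i}.
Qed.

Lemma singular_value_attained m p (B : 'M[R]_(m, p)) i : (i < p)%N ->
  exists2 x : 'cV[R]_p, norm2 x = 1 & norm2 (B *m x) = (singular_values B)`_i.
Proof.
move=> ip; have [Q [d [QQ _ nB pe]]] := gram_eigenbasis B.
have : (singular_values B)`_i ^+ 2 \in [seq d i | i <- index_enum 'I_p].
  by rewrite (perm_mem pe); apply: map_f; apply: mem_nth; rewrite size_singular_values.
case/mapP => l _ dl; exists (Q *m delta_mx l 0).
  rewrite norm2_orth//; apply/eqP; rewrite -(@eqrXn2 _ 2) ?norm2_ge0//.
  rewrite norm2_sum_sqr (bigD1 l)//= mxE !eqxx big1 ?addr0 ?expr1n// => j jl.
  by rewrite mxE (negbTE jl) expr0n.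
apply/eqP; rewrite -(@eqrXn2 _ 2) ?norm2_ge0 ?singular_values_ge0//.
rewrite nB dl (bigD1 l)//= mxE !eqxx big1 ?addr0 ?expr1n ?mulr1// => j jl.
by rewrite mxE (negbTE jl) expr0n mulr0.
Qed.

Lemma singular_value_ge m p (B : 'M[R]_(m, p)) c i : (i < p)%N ->
  (forall x, c * norm2 x <= norm2 (B *m x)) -> c <= (singular_values B)`_i.
Proof.
move=> ip cB; have [x x1 <-] := singular_value_attained B ip.
by rewrite -[c]mulr1 -x1.
Qed.

(** Courant-Fischer: the eigenvectors of B^T B for the i+1 largest eigenvalues
    span a space of dimension i+1, which meets the kernel of any W of rank at
    most i. *)
Lemma singular_value_le m p q (B : 'M[R]_(m, p)) (W : 'M[R]_(q, p)) c i :
  (i < p)%N -> (\rank W <= i)%N ->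
  (forall x, W *m x = 0 -> norm2 (B *m x) <= c * norm2 x) ->
  (singular_values B)`_i <= c.
Proof.
move=> ip rW cB; have [Q [d [QQ _ nB pe]]] := gram_eigenbasis B.
have QQ' : Q *m Q^T = 1%:M by exact: mulmx1C.
set s := (singular_values B)`_i.
pose I : {set 'I_p} := [set l | s ^+ 2 <= d l]%SET.
have cI : (i < #|I|)%N.
  have -> : #|I| = count (>= s ^+ 2) [seq d i | i <- index_enum 'I_p].
    by rewrite -sum1_card count_map -sum1_count; apply: eq_bigl => l; rewrite inE.
  rewrite (seq.permP pe) count_map.
  rewrite -(cat_take_drop i.+1 (singular_values B)) count_cat.
  apply: leq_trans (leq_addr _ _).
  have sz : size (take i.+1 (singular_values B)) = i.+1.
    by rewrite size_takel// size_singular_values.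
  rewrite -[X in (X <= _)%N]sz -[X in (X <= _)%N]count_predT.
  rewrite leq_eqVlt; apply/orP; left; apply/eqP; apply: eq_in_count => x.
  case/(nthP 0) => j; rewrite sz => ji <-; rewrite nth_take//= ler_pXn2r//.
  - by rewrite singular_values_homo.
  - by rewrite nnegrE singular_values_ge0.
  - by rewrite nnegrE singular_values_ge0.
pose E : 'M[R]_(#|I|, p) := \matrix_(a, b) (enum_val a == b)%:R.
pose M := E *m (W *m Q)^T.
have rM : (0 < \rank (kermx M))%N.
  rewrite mxrank_ker subn_gt0; apply: leq_ltn_trans cI.
  apply: leq_trans (mxrankM_maxr _ _) _; rewrite mxrank_tr.
  exact: leq_trans (mxrankM_maxl _ _) rW.
have [z zM z0] : exists2 z : 'rV_#|I|, z *m M = 0 & z != 0.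
  exists (nz_row (kermx M)).
    by apply/sub_kermxP; exact: nz_row_sub.
  by rewrite nz_row_eq0 -mxrank_eq0 -lt0n.
pose y := (z *m E)^T.
have yE l : y l 0 = if l \in I then z 0 (enum_rank_in (enum_valP (Ordinal cI)) l) else 0.
  rewrite !mxE; case: ifPn => [lI|lI]; last first.
    rewrite big1// => a _; rewrite mxE; have [al|] := eqVneq; last by rewrite mulr0.
    by move: lI; rewrite -al enum_valP.
  rewrite (bigD1 (enum_rank_in (enum_valP (Ordinal cI)) l))//= mxE.
  rewrite enum_rankK_in// eqxx mulr1 big1 ?addr0// => a.
  rewrite mxE; have [<-|] := eqVneq (enum_val a) l; last by rewrite mulr0.
  by rewrite enum_valK_in eqxx.
have y0 : 0 < norm2 y.
  rewrite norm2_gt0; apply: contra z0 => /eqP y0; apply/eqP/rowP => a.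
  have /(congr1 (fun v : 'cV_p => v (enum_val a) 0)) := y0.
  by rewrite yE enum_valP enum_valK_in !mxE.
have Wx : W *m (Q *m y) = 0.
  apply: trmx_inj; rewrite mulmxA trmx_mul /y trmxK -mulmxA.
  by rewrite -/M zM trmx0.
have h1 := cB _ Wx; rewrite norm2_orth// in h1.
have h2 : s * norm2 y <= norm2 (B *m (Q *m y)).
  rewrite -(@ler_pXn2r _ 2) ?nnegrE ?mulr_ge0 ?norm2_ge0 ?singular_values_ge0//.
  rewrite nB exprMn norm2_sum_sqr mulr_sumr ler_sum// => l _.
  rewrite yE; case: ifPn => [|_]; last by rewrite expr0n !mulr0.
  by rewrite inE => sd; rewrite ler_wpM2r ?sqr_ge0.
by have := le_trans h2 h1; rewrite ler_pM2r.
Qed.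

Lemma det_gramM m p (A : 'M[R]_(m, p)) (C : 'M[R]_p) :
  \det ((A *m C)^T *m (A *m C)) = \det C ^+ 2 * \det (A^T *m A).
Proof.
have -> : (A *m C)^T *m (A *m C) = C^T *m (A^T *m A) *m C.
  by rewrite trmx_mul !mulmxA.
by rewrite !det_mulmx !det_tr; ring.
Qed.

Lemma gram_det m p (B : 'M[R]_(m, p)) :
  \det (B^T *m B) = (\prod_(s <- singular_values B) s) ^+ 2.
Proof.
have [Q [d [QQ DE nB pe]]] := gram_eigenbasis B.
have := congr1 determinant DE; rewrite det_diag det_gramM.
rewrite expr2 -{1}det_tr -det_mulmx QQ det1 mul1r => ->.
rewrite -prodrXl -(big_map (fun x => x ^+ 2) xpredT id) -(perm_big _ pe)/= big_map.
by apply: eq_bigr => i _; rewrite mxE.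
Qed.

Lemma volE m p (B : 'M[R]_(m, p)) :
  vol B = \prod_(i < p) (singular_values B)`_i.
Proof.
rewrite /vol gram_det sqrtr_sqr ger0_norm; last first.
  have [_ /allP s0 _] := singular_valuesP B.
  by rewrite big_seq prodr_ge0// => x /s0.
by rewrite (big_nth 0) size_singular_values big_mkord.
Qed.

Lemma vol_ge0 m p (B : 'M[R]_(m, p)) : 0 <= vol B.
Proof. exact: sqrtr_ge0. Qed.

Lemma vol_ge m p (B : 'M[R]_(m, p)) c : 0 <= c ->
  (forall x, c * norm2 x <= norm2 (B *m x)) -> c ^+ p <= vol B.
Proof.
move=> c0 cB; rewrite volE -[X in c ^+ X]card_ord -prodr_const.
by apply: ler_prod => i _; rewrite c0 singular_value_ge.
Qed.

Lemma volZ m p (B : 'M[R]_(m, p)) c : 0 <= c -> vol (c *: B) = c ^+ p * vol B.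
Proof.
move=> c0; rewrite /vol.
have -> : (c *: B)^T = c *: B^T by apply/matrixP => i j; rewrite !mxE.
rewrite -scalemxAl -scalemxAr scalerA detZ.
by rewrite -expr2 exprAC sqrtrM ?sqr_ge0// sqrtr_sqr ger0_norm// exprn_ge0.
Qed.

(** If vol B is not 0, right multiplication by the matrix Q E below turns B into
    an isometry; the hypothesis then bounds the singular values of A Q E from
    below, and the determinant of Q E is the inverse of vol B up to sign. *)
Lemma vol_le m p (A B : 'M[R]_(m, p)) c : 0 <= c ->
  (forall x, c * norm2 (B *m x) <= norm2 (A *m x)) -> c ^+ p * vol B <= vol A.
Proof.
move=> c0 cAB; have [vB0|vB0] := eqVneq (vol B) 0; first by rewrite vB0 mulr0 vol_ge0.
have [Q [d [QQ DE nB pe]]] := gram_eigenbasis B.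
have vB : vol B ^+ 2 = \prod_i d i.
  rewrite /vol gram_det sqr_sqrtr ?sqr_ge0// -gram_det.
  have := congr1 determinant DE; rewrite det_diag det_gramM.
  rewrite expr2 -{1}det_tr -det_mulmx QQ det1 mul1r => ->.
  by apply: eq_bigr => i _; rewrite mxE.
have d_ge0 i : 0 <= d i.
  have : d i \in [seq s ^+ 2 | s <- singular_values B].
    by rewrite -(perm_mem pe); apply: map_f; rewrite mem_index_enum.
  by case/mapP => s _ ->; rewrite sqr_ge0.
have d_gt0 i : 0 < d i.
  rewrite lt_neqAle d_ge0 andbT eq_sym; apply: contra vB0 => /eqP di.
  by rewrite -sqrf_eq0 vB (bigD1 i)//= di mul0r.
pose E : 'M[R]_p := diag_mx (\row_i (Num.sqrt (d i))^-1).
have detE : \det E = (vol B)^-1.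
  rewrite det_diag; under eq_bigr do rewrite mxE.
  rewrite prodfV; congr (_^-1); apply/eqP.
  rewrite -(@eqrXn2 _ 2) ?vol_ge0 ?prodr_ge0//.
  rewrite vB -prodrXl; apply/eqP; apply: eq_bigr => i _.
  by rewrite sqr_sqrtr.
have nE y : norm2 (B *m (Q *m (E *m y))) = norm2 y.
  apply/eqP; rewrite -(@eqrXn2 _ 2) ?norm2_ge0// nB norm2_sum_sqr.
  apply/eqP; apply: eq_bigr => i _.
  rewrite mul_diag_mx !mxE exprMn exprVn sqr_sqrtr// mulrA divff ?mul1r//.
  by rewrite gt_eqF.
have : c ^+ p <= vol (A *m (Q *m E)).
  apply: vol_ge => // x; rewrite -!mulmxA -{1}(nE x).
  exact: cAB.
have -> : vol (A *m (Q *m E)) = vol A / vol B.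
  rewrite /vol det_gramM det_mulmx detE exprMn.
  have -> : \det Q ^+ 2 = 1 by rewrite expr2 -{1}det_tr -det_mulmx QQ det1.
  by rewrite mul1r sqrtrM ?sqr_ge0// sqrtr_sqr ger0_norm ?invr_ge0 ?vol_ge0// mulrC.
by rewrite ler_pdivlMr// lt_neqAle eq_sym vB0 vol_ge0.
Qed.
End SingularValues.

(** * Column submatrices *)

Section ColumnSelection.
Variable R : realType.
Implicit Types m n p q : nat.

Lemma vol_colsub_image m n p q (Z : 'M[R]_(m, n)) (f : 'I_p -> 'I_n)
    (g : 'I_q -> 'I_n) : p = q -> injective f -> injective g ->
  (forall a, exists b, f a = g b) -> vol (colsub f Z) = vol (colsub g Z).
Proof.
move=> pq; case: q / pq g => g finj ginj fg.
have [s sE] := boolp.choice fg.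
have sinj : injective s by move=> a b sab; apply: finj; rewrite !sE sab.
have -> : colsub f Z = colsub g Z *m perm_mx (perm sinj)^-1.
  rewrite -col_permE; apply/matrixP => i a.
  by rewrite !mxE permE sE.
by rewrite /vol det_gramM det_perm -exprM mulnC exprM sqrrN expr1n expr1n mul1r.
Qed.

(** Right multiplication by this matrix selects columns, so that a statement
    about a column submatrix becomes one about the whole matrix. *)
Definition sel_mx n p (f : 'I_p -> 'I_n) : 'M[R]_(n, p) :=
  \matrix_(i, a) (i == f a)%:R.

Lemma mul_sel_mx m n p (Z : 'M[R]_(m, n)) (f : 'I_p -> 'I_n) :
  Z *m sel_mx f = colsub f Z.
Proof.
apply/matrixP => i a; rewrite !mxE (bigD1 (f a))//= mxE eqxx mulr1 big1 ?addr0// => j ja.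
by rewrite mxE (negbTE ja) mulr0.
Qed.

Lemma norm2_sel_mx n p (f : 'I_p -> 'I_n) (x : 'cV[R]_p) : injective f ->
  norm2 (sel_mx f *m x) = norm2 x.
Proof.
move=> finj; apply/eqP; rewrite -(@eqrXn2 _ 2) ?norm2_ge0//.
rewrite !norm2_sqr dot_mulmx mulmxA.
suff -> : (sel_mx f)^T *m sel_mx f = 1%:M by rewrite mul1mx.
apply/matrixP => a b; rewrite mul_sel_mx !mxE.
by rewrite (inj_eq finj) eq_sym.
Qed.

Lemma sel_mx_supp n p (f : 'I_p -> 'I_n) (x : 'cV[R]_p) i :
  (forall a, f a != i) -> (sel_mx f *m x) i 0 = 0.
Proof.
move=> fi; rewrite mxE big1// => a _.
by rewrite mxE eq_sym (negbTE (fi a)) mul0r.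
Qed.

Lemma mulmx_sum_col m n (Z : 'M[R]_(m, n)) (x : 'cV[R]_n) :
  Z *m x = \sum_i x i 0 *: col i Z.
Proof.
apply/colP => a; rewrite mxE summxE; apply: eq_bigr => i _.
by rewrite !mxE mulrC.
Qed.

End ColumnSelection.

(** * The state of a column pivoting run *)

Section Pivoting.
Variables (R : realType) (n : nat) (Z : 'M[R]_n).

(** What a run with pivots ys (oldest first) knows after p steps.  The pivot at
    step j is the residual y_j of the column selected there.
    - piv_span and piv_vol: P projects onto the span of the selected columns, and
      these have volume the product of the pivot norms, as in a QR factorisation.
    - piv_dot says that the entries of the triangular factor are at most the
      diagonal entry of their row.  By back substitution the coefficients c of
      a combination of the selected columns then satisfy
      |c_j| <= h (1 + 1 + 2 + ... ) = 2^(p - j) h, whence the sum of powers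
      of 4 in piv_coef.
    - piv_low: the projection of stage j has rank at most j, kills j columns and
      leaves residuals no longer than the pivot of that stage.  This is what
      bounds singular values from above. *)
Record pivoting (p : nat) (S T : {set 'I_n}) (P : 'M[R]_n)
    (f : 'I_p -> 'I_n) (M : 'M[R]_(p, n)) (ys : seq 'cV[R]_n) : Prop :=
  Pivoting {
    piv_size : size ys = p;
    piv_T : T = ~: S;
    piv_inj : injective f;
    piv_image : forall i, (i \in S) = [exists a, f a == i];
    piv_sym : P^T = P;
    piv_idem : P *m P = P;
    piv_rank : (\rank P <= p)%N;
    piv_fix : forall i, i \in S -> P *m col i Z = col i Z;
    piv_span : P = colsub f Z *m M;
    piv_vol : vol (colsub f Z) = \prod_(y <- ys) norm2 y;
    piv_dot : forall y i, y \in ys -> i \in T -> `|dot y (col i Z)| <= dot y y;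
    piv_res : forall y i, y \in ys -> i \in T ->
      norm2 ((1%:M - P) *m col i Z) <= norm2 y;
    piv_last : forall y, y \in ys -> norm2 (last 0 ys) <= norm2 y;
    piv_coef : (forall y, y \in ys -> y != 0) ->
      forall (c : 'cV[R]_n) h, (forall i, i \notin S -> c i 0 = 0) ->
      (forall y, y \in ys -> `|dot y (Z *m c)| <= h * dot y y) ->
      3 * norm2 c ^+ 2 <= (4 ^+ p - 1) * h ^+ 2;
    piv_low : forall j, (j < p)%N -> exists (P' : 'M[R]_n) (U : {set 'I_n}),
      [/\ (\rank P' <= j)%N, #|U| = j,
          forall i, i \in U -> (1%:M - P') *m col i Z = 0 &
          forall i, norm2 ((1%:M - P') *m col i Z) <= norm2 ys`_j] }.

Lemma piv_card p S T P f M ys : @pivoting p S T P f M ys -> #|S| = p.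
Proof.
move=> H; have -> : S = [set f a | a : 'I_p]%SET.
  apply/setP => i; rewrite (piv_image H).
  by apply/existsP/imsetP => [[a /eqP<-]|[a _ ->]]; exists a.
by rewrite card_imset ?card_ord//; exact: (piv_inj H).
Qed.

Lemma pivoting0 (f : 'I_0 -> 'I_n) :
  pivoting finset.set0 [set: 'I_n]%SET 0 f 0 [::].
Proof.
split => //.
- by rewrite finset.setC0.
- by case.
- by move=> i; rewrite inE; apply/esym/negbTE/existsPn => -[].
- by rewrite trmx0.
- by rewrite mul0mx.
- by rewrite mxrank0.
- by move=> i; rewrite inE.
- by rewrite mulmx0.
- by rewrite /vol det_mx00 sqrtr1 big_nil.
- move=> _ c h c0 _.
  have -> : c = 0 by apply/colP => i; rewrite c0 ?inE// mxE.
  by rewrite norm20 expr0n mulr0 expr0 subrr mul0r.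
Qed.

Lemma pivotingS p S T P f M ys t : @pivoting p S T P f M ys -> t \in T ->
  (forall i, i \in T ->
       norm2 ((1%:M - P) *m col i Z) <= norm2 ((1%:M - P) *m col t Z)) ->
  let y := (1%:M - P) *m col t Z in
  exists f' M', @pivoting p.+1 (t |: S)%SET (T :\ t)%SET
      (P + y *m ((norm2 y ^+ 2)^-1 *: y^T)) f' M' (rcons ys y).
Proof.
move=> H tT tmax y; set w := (norm2 y ^+ 2)^-1.
set P' := P + _.
have tS : t \notin S by move: tT; rewrite (piv_T H) inE.
have Ty i : (i \in T) = (i \notin S) by rewrite (piv_T H) inE.
have P1P : P *m (1%:M - P) = 0 by rewrite mulmxBr mulmx1 (piv_idem H) subrr.
have Py : P *m y = 0 by rewrite /y mulmxA P1P mul0mx.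
have IPy : (1%:M - P) *m y = y by rewrite mulmxBl mul1mx Py subr0.
have IPT : (1%:M - P)^T = 1%:M - P.
  by rewrite raddfB/= trmx1 (piv_sym H).
have dyP v : dot y v = dot y ((1%:M - P) *m v) by rewrite dot_mulmx IPT IPy.
have yS i : i \in S -> dot y (col i Z) = 0.
  by move=> iS; rewrite dyP mulmxBl mul1mx (piv_fix H)// subrr dotv0.
have yt : dot y (col t Z) = dot y y by rewrite dyP.
have wE : w = (dot y y)^-1 by rewrite /w norm2_sqr.
(* The two identities below also hold for y = 0, where w = 0. *)
have wwy : w * (w * dot y y) = w.
  rewrite wE; have [->|y0] := eqVneq (dot y y) 0; first by rewrite invr0 mul0r.
  by rewrite mulVf// mulr1.
have yyw : (w * dot y y) *: y = y.
  have [->|y0] := eqVneq y 0; first by rewrite scaler0.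
  by rewrite wE mulVf ?scale1r// -norm2_sqr sqrf_eq0 norm2_eq0.
have P'E v : P' *m v = P *m v + (w * dot y v) *: y.
  rewrite mulmxDl; congr (_ + _); rewrite -mulmxA -scalemxAl.
  have -> : y^T *m v = (dot y v)%:M by rewrite [LHS]mx11_scalar.
  by rewrite -scalemxAr mul_mx_scalar scalerA.
have resP' v : norm2 ((1%:M - P') *m v) <= norm2 ((1%:M - P) *m v).
  have -> : (1%:M - P') *m v = (1%:M - P) *m v - (w * dot y v) *: y.
    by rewrite !mulmxBl !mul1mx P'E opprD addrA.
  rewrite dyP; move: ((1%:M - P) *m v) => u.
  rewrite -(@ler_pXn2r _ 2) ?nnegrE ?norm2_ge0// !norm2_sqr.
  have -> : dot (u - (w * dot y u) *: y) (u - (w * dot y u) *: y) = dot u u - w * dot y u ^+ 2.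
    rewrite -scaleNr !(dotDl, dotDr) !(dotZl, dotZr) (dotC u y).
    have -> : - (w * dot y u) * (- (w * dot y u) * dot y y) =
        w * (w * dot y y) * (dot y u) ^+ 2 by ring.
    by rewrite wwy; ring.
  rewrite gerBl mulr_ge0 ?sqr_ge0// wE invr_ge0; exact: dotvv_ge0.
pose f' (a : 'I_(1 + p)) := match fintype.split a with inl _ => t | inr b => f b end.
have Zf' : colsub f' Z = row_mx (col t Z) (colsub f Z).
  apply/matrixP => i a; rewrite [LHS]mxE [RHS]mxE /f'.
  by case: fintype.splitP => b ab; rewrite !mxE.
pose M' : 'M[R]_(1 + p, n) := col_mx (w *: y^T) (M - M *m col t Z *m (w *: y^T)).
exists f', M'; split.
- by rewrite size_rcons (piv_size H).
- by rewrite (piv_T H); apply/setP => i; rewrite !inE negb_or.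
- move=> a b; rewrite /f'.
  have ft c : f c != t.
    by apply: contraNneq tS => <-; rewrite (piv_image H); apply/existsP; exists c.
  case: fintype.splitP => a' aa'; case: fintype.splitP => b' bb'.
  + by move=> _; apply: val_inj; rewrite /= aa' bb' !ord1.
  + by move/esym/eqP; rewrite (negbTE (ft _)).
  + by move/eqP; rewrite (negbTE (ft _)).
  + by move=> /(piv_inj H) ab; apply: val_inj; rewrite /= aa' bb' ab.
- move=> i; rewrite !inE (piv_image H); apply/orP/existsP => [[/eqP->|/existsP[a /eqP <-]]|[a]].
  + by exists (lshift p (@ord0 0)); rewrite /f' (unsplitK (inl _)).
  + by exists (rshift 1 a); rewrite /f' (unsplitK (inr _)).
  + rewrite /f'; case: fintype.splitP => b _ /eqP <-; first by left.
    by right; apply/existsP; exists b.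
- rewrite /P' raddfD/= (piv_sym H) -scalemxAr; congr (_ + _).
  by rewrite linearZ/= trmx_mul trmxK.
- apply/matrixP => i j.
  suff : forall v : 'cV_n, P' *m P' *m v = P' *m v.
    by move=> /(_ (delta_mx j 0)); rewrite -!colE => /colP/(_ i); rewrite !mxE.
  move=> v; rewrite -mulmxA !P'E mulmxDr -scalemxAr Py scaler0 addr0.
  rewrite mulmxA (piv_idem H); congr (_ + _); congr (_ *: _).
  rewrite dotDr dotZr; have -> : dot y (P *m v) = 0.
    by rewrite dot_mulmx (piv_sym H) Py dot0v.
  rewrite add0r; transitivity (w * (w * dot y y) * dot y v); first by ring.
  by rewrite wwy.
- apply: leq_trans (mxrank_add _ _) _; rewrite -[p.+1]addn1 leq_add// ?(piv_rank H)//.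
  by apply: leq_trans (mxrankM_maxr _ _) _; exact: rank_leq_row.
- move=> i; rewrite !inE => /orP[/eqP->|iS]; rewrite P'E.
    by rewrite yt yyw /y mulmxBl mul1mx addrC subrK.
  by rewrite yS// mulr0 scale0r addr0 (piv_fix H).
- have E : (colsub f' Z : 'M[R]_(n, 1 + p)) *m M' =
      col t Z *m (w *: y^T) + colsub f Z *m (M - M *m col t Z *m (w *: y^T)).
    by rewrite Zf' /M' mul_row_col.
  apply: etrans (esym E); rewrite mulmxBr !mulmxA -(piv_span H).
  rewrite /P' {1}/y mulmxBl mul1mx mulmxBl addrCA; congr (_ + _).
- rewrite big_rcons/= -(piv_vol H).
  suff : vol (row_mx (col t Z) (colsub f Z)) = vol (colsub f Z) * norm2 y.
    by rewrite -Zf'.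
  (* A unipotent column operation replaces the new column by its residual y,
     which is orthogonal to the columns selected before. *)
  have -> : row_mx (col t Z) (colsub f Z) = row_mx y (colsub f Z) *m
      block_mx 1%:M 0 (M *m col t Z) 1%:M.
    rewrite mul_row_block !mulmx1 mulmx0 add0r mulmxA -(piv_span H).
    by rewrite /y mulmxBl mul1mx subrK.
  rewrite /vol det_gramM det_lblock !det1 mulr1 expr1n mul1r.
  rewrite tr_row_mx mul_col_row.
  have yZ : y^T *m colsub f Z = 0.
    apply/rowP => a; rewrite [RHS]mxE -[RHS](yS (f a)); last first.
      by rewrite (piv_image H); apply/existsP; exists a.
    by rewrite dotE mxE; apply: eq_bigr => i _; rewrite !mxE.
  rewrite yZ det_lblock det_mx11 sqrtrM; last exact: dotvv_ge0.
  by rewrite -/(dot y y) -norm2_sqr sqrtr_sqr ger0_norm ?norm2_ge0// mulrC.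
- move=> z i; rewrite mem_rcons !inE => /orP[/eqP->|zy] /andP[_ iT].
    rewrite dyP; apply: le_trans (dot_le_norm2 _ _) _.
    by rewrite -norm2_sqr expr2 ler_wpM2l ?norm2_ge0// tmax.
  exact: (piv_dot H).
- move=> z i; rewrite mem_rcons !inE => /orP[/eqP->|zy] /andP[_ iT].
    by apply: le_trans (resP' _) _; exact: tmax.
  by apply: le_trans (resP' _) _; exact: (piv_res H).
- move=> z; rewrite last_rcons mem_rcons inE => /orP[/eqP->//|zy].
  exact: (piv_res H).
- move=> y0 c h cS ch.
  pose c' : 'cV[R]_n := c - c t 0 *: delta_mx t 0.
  have cE : c = c' + c t 0 *: delta_mx t 0 by rewrite subrK.
  have c't : c' t 0 = 0 by rewrite !mxE !eqxx mulr1 subrr.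
  have c'S i : i \notin S -> c' i 0 = 0.
    move=> iS; have [->|it] := eqVneq i t; first exact: c't.
    by rewrite !mxE (negbTE it) mulr0 subr0 cS// !inE negb_or it.
  have Zc : Z *m c = Z *m c' + c t 0 *: col t Z.
    by rewrite {1}cE mulmxDr -scalemxAr -colE.
  have nc : norm2 c ^+ 2 = norm2 c' ^+ 2 + c t 0 ^+ 2.
    rewrite !norm2_sum_sqr (bigD1 t)//= [in RHS](bigD1 t)//= c't expr0n add0r addrC.
    congr (_ + _); apply: eq_bigr => i it.
    by rewrite !mxE (negbTE it) mulr0 subr0.
  have yc' : dot y (Z *m c') = 0.
    rewrite mulmx_sum_col; rewrite /dot mulmx_sumr summxE big1// => i _.
    rewrite -scalemxAr mxE -/(dot y (col i Z)).
    by have [iS|iS] := boolP (i \in S); [rewrite yS ?mulr0|rewrite c'S ?mul0r].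
  have yn0 : 0 < dot y y.
    by rewrite -norm2_sqr exprn_gt0// norm2_gt0 y0// mem_rcons mem_head.
  have cth : `|c t 0| <= h.
    have := ch y; rewrite mem_rcons mem_head => /(_ isT).
    rewrite Zc dotDr yc' add0r dotZr yt normrM (gtr0_norm yn0).
    by rewrite ler_pM2r.
  have h0 : 0 <= h := le_trans (normr_ge0 _) cth.
  (* Removing the newest column from the combination doubles h at worst. *)
  have : 3 * norm2 c' ^+ 2 <= (4 ^+ p - 1) * (2 * h) ^+ 2.
    apply: (piv_coef H) => //.
      by move=> z zy; apply: y0; rewrite mem_rcons inE zy orbT.
    move=> z zy.
    have -> : Z *m c' = Z *m c - c t 0 *: col t Z by rewrite Zc addrK.
    rewrite -scaleNr dotDr dotZr; apply: le_trans (ler_normD _ _) _.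
    have h1 : `|dot z (Z *m c)| <= h * dot z z.
      by apply: ch; rewrite mem_rcons inE zy orbT.
    rewrite normrM normrN; have h2 := piv_dot H zy tT.
    have h3 : `|c t 0| * `|dot z (col t Z)| <= h * dot z z.
      by apply: ler_pM.
    lra.
  have : c t 0 ^+ 2 <= h ^+ 2.
    by rewrite -[c t 0 ^+ 2]real_normK ?num_real// ler_pXn2r ?nnegrE.
  rewrite nc (exprS 4); move: (4 ^+ p) (norm2 c' ^+ 2) (c t 0 ^+ 2) => A B C h1.
  rewrite exprMn; lra.
- move=> j; rewrite ltnS leq_eqVlt => /orP[/eqP->|jp].
    exists P, S; split.
    + exact: (piv_rank H).
    + exact: piv_card H.
    + by move=> i iS; rewrite mulmxBl mul1mx (piv_fix H)// subrr.
    + move=> i; rewrite nth_rcons (piv_size H) ltnn eqxx.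
      have [iS|iS] := boolP (i \in S); last by apply: tmax; rewrite Ty.
      by rewrite mulmxBl mul1mx (piv_fix H)// subrr norm20 norm2_ge0.
  have [P1 [U [h1 h2 h3 h4]]] := piv_low H jp.
  by exists P1, U; split => // i; rewrite nth_rcons (piv_size H) jp.
Qed.

Lemma bg_state_pivoting j S T P : bg_state Z j S T P ->
  exists f M ys, @pivoting j S T P f M ys.
Proof.
elim=> [|{}j {}S {}T {}P t _ [f [M [ys H]]] tT tmax y].
  have f : 'I_0 -> 'I_n by case.
  by exists f, 0, [::]; exact: pivoting0.
have [f' [M' H']] := pivotingS H tT tmax.
by exists f', M', (rcons ys y).
Qed.

Lemma bg_state_exists j : (j <= n)%N -> exists S T P, bg_state Z j S T P.
Proof.
elim: j => [|j IH] jn; first by do 3 eexists; exact: bg_init.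
have [S [T [P b]]] := IH (ltnW jn).
have [f [M [ys H]]] := bg_state_pivoting b.
have [t0 t0T] : exists t, t \in T.
  apply/set0Pn; rewrite (piv_T H) -card_gt0 cardsCs finset.setCK card_ord subn_gt0.
  by rewrite (piv_card H).
pose t := [arg max_(i > t0 in T) norm2 ((1%:M - P) *m col i Z)]%O.
exists (t |: S)%SET, (T :\ t)%SET; eexists.
rewrite /t; case: Order.TotalTheory.arg_maxP => //= s sT smax.
exact: bg_step b sT smax.
Qed.

End Pivoting.

(** * Pivoting on a perturbed matrix *)

Section Perturbation.
Variable R : realType.
Implicit Types m n p : nat.

Lemma norm2_mulmx_frobenius m p (A : 'M[R]_(m, p)) x :
  norm2 (A *m x) ^+ 2 <= (\sum_i norm2 (col i A) ^+ 2) * norm2 x ^+ 2.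
Proof.
pose a : 'cV[R]_p := \col_i norm2 (col i A).
pose b : 'cV[R]_p := \col_i `|x i 0|.
have ab : norm2 (A *m x) <= norm2 a * norm2 b.
  apply: le_trans (dot_le_norm2 a b); apply: le_trans (ler_norm _).
  rewrite mulmx_sum_col; apply: le_trans (norm2_sum _) _.
  by rewrite dotE ler_sum// => i _; rewrite norm2Z !mxE mulrC.
have -> : \sum_i norm2 (col i A) ^+ 2 = norm2 a ^+ 2.
  by rewrite norm2_sum_sqr; apply: eq_bigr => i _; rewrite mxE.
have -> : norm2 x ^+ 2 = norm2 b ^+ 2.
  by rewrite !norm2_sum_sqr; apply: eq_bigr => i _; rewrite mxE real_normK ?num_real.
by rewrite -exprMn ler_pXn2r ?nnegrE ?mulr_ge0 ?norm2_ge0.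
Qed.

Lemma norm2_mulmx_le_cols m p (A : 'M[R]_(m, p)) (U : {set 'I_p}) r x :
  0 <= r -> (forall i, i \in U -> col i A = 0) ->
  (forall i, norm2 (col i A) <= r) ->
  norm2 (A *m x) <= Num.sqrt (p - #|U|)%:R * r * norm2 x.
Proof.
move=> r0 AU Ar.
rewrite -(@ler_pXn2r _ 2) ?nnegrE ?mulr_ge0 ?sqrtr_ge0 ?norm2_ge0//.
apply: le_trans (norm2_mulmx_frobenius _ _) _.
rewrite !exprMn ler_wpM2r ?sqr_ge0// sqr_sqrtr ?ler0n//.
rewrite (bigID (mem U))/= big1 ?add0r => [|i iU]; last by rewrite AU// norm20 expr0n.
have -> : (p - #|U|)%N = #|~: U| by rewrite [RHS]cardsCs finset.setCK card_ord.
rewrite -sum1_card natr_sum mulr_suml.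
rewrite (eq_bigl (mem (~: U))); last by move=> i; rewrite !inE.
by apply: ler_sum => i _; rewrite mul1r ler_pXn2r ?nnegrE ?norm2_ge0.
Qed.

Section Run.
Variables (n k : nat) (X E : 'M[R]_n) (nu : R) (S T : {set 'I_n}) (P : 'M[R]_n).
Variables (f : 'I_k -> 'I_n) (M : 'M[R]_(k, n)) (ys : seq 'cV[R]_n).
Hypothesis H : pivoting (X + E) S T P f M ys.
Hypothesis hE : forall x, norm2 (E *m x) <= nu * norm2 x.

Lemma pivoting_vol : vol (col_submx (X + E) S) = \prod_(y <- ys) norm2 y.
Proof.
rewrite -(piv_vol H); apply: vol_colsub_image.
- exact: piv_card H.
- exact: enum_val_inj.
- exact: (piv_inj H).
- move=> a; have := enum_valP a; rewrite (piv_image H) => /existsP[b /eqP fb].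
  by exists b.
Qed.

(** On the kernel of P' (X + E), with P' the projection of stage j, the product
    X x differs from the residual (1 - P') (X + E) x by E x only; the residual
    matrix has at most n - j nonzero columns, each no longer than the j-th pivot. *)
Lemma singular_value_le_pivot j : (j < k)%N -> (k <= n)%N ->
  (singular_values X)`_j <= Num.sqrt (n - j)%:R * norm2 ys`_j + nu.
Proof.
move=> jk kn; have [P' [U [rP cU PU Pr]]] := piv_low H jk.
apply: (@singular_value_le _ _ _ _ X (P' *m (X + E))).
- exact: leq_trans jk kn.
- exact: leq_trans (mxrankM_maxl _ _) rP.
move=> x Px; have -> : X *m x = (1%:M - P') *m (X + E) *m x - E *m x.
  by rewrite mulmxBl mul1mx mulmxBl Px subr0 mulmxDl addrK.
apply: le_trans (norm2D _ _) _; rewrite norm2N mulrDl lerD// -cU.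
have cP i : col i ((1%:M - P') *m (X + E)) = (1%:M - P') *m col i (X + E).
  by rewrite !colE mulmxA.
apply: norm2_mulmx_le_cols => [|i iU|i]; first exact: norm2_ge0.
- by rewrite cP PU.
- by rewrite cP cU; exact: Pr.
Qed.

Lemma singular_value_sel_le_pivot q (g : 'I_q -> 'I_n) j : (j < k)%N ->
  (j < q)%N -> injective g ->
  (singular_values (colsub g X))`_j <= Num.sqrt q%:R * norm2 ys`_j + nu.
Proof.
move=> jk jq ginj; have [P' [U [rP cU PU Pr]]] := piv_low H jk.
apply: (@singular_value_le _ _ _ _ _ (P' *m colsub g (X + E))) => //.
  exact: leq_trans (mxrankM_maxl _ _) rP.
move=> x Px; have -> : colsub g X *m x =
    (1%:M - P') *m colsub g (X + E) *m x - E *m (sel_mx R g *m x).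
  rewrite mulmxBl mul1mx mulmxBl Px subr0 -!mul_sel_mx.
  by rewrite mulmxDl mulmxDl !mulmxA addrK.
apply: le_trans (norm2D _ _) _; rewrite norm2N mulrDl lerD//; last first.
  by apply: le_trans (hE _) _; rewrite norm2_sel_mx.
have := @norm2_mulmx_le_cols _ _ ((1%:M - P') *m colsub g (X + E)) finset.set0 (norm2 ys`_j) x.
rewrite cards0 subn0; apply.
- exact: norm2_ge0.
- by move=> i; rewrite inE.
- move=> i; apply: le_trans (Pr (g i)).
  rewrite colE -mulmxA -colE.
  by have -> : col i (colsub g (X + E)) = col (g i) (X + E) by apply/colP => a; rewrite !mxE.
Qed.

Lemma nth_pivot_ge_last j : (j < k)%N -> norm2 (last 0 ys) <= norm2 ys`_j.
Proof. by move=> jk; apply: (piv_last H); rewrite mem_nth ?(piv_size H). Qed.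

Lemma norm2_selected_ge (x : 'cV[R]_#|S|) : 0 < norm2 (last 0 ys) ->
  3 * (norm2 (last 0 ys) * norm2 x) ^+ 2 <=
  (4 ^+ k - 1) * norm2 (col_submx (X + E) S *m x) ^+ 2.
Proof.
set r := norm2 (last 0 ys) => r0.
set g := @enum_val _ (mem S).
have ginj : injective g by exact: enum_val_inj.
set v := col_submx (X + E) S *m x.
have vE : (X + E) *m (sel_mx R g *m x) = v by rewrite mulmxA mul_sel_mx.
have := (piv_coef H) _ (sel_mx R g *m x) (norm2 v / r).
rewrite vE norm2_sel_mx// => h.
have {h} : 3 * norm2 x ^+ 2 <= (4 ^+ k - 1) * (norm2 v / r) ^+ 2.
  apply: h.
  - by move=> y yy; rewrite -norm2_gt0 (lt_le_trans r0)// (piv_last H).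
  - move=> i iS; apply: sel_mx_supp => a; apply: contraNneq iS => <-.
    exact: enum_valP.
  - move=> y yy; apply: le_trans (dot_le_norm2 _ _) _.
    have ry := piv_last H yy.
    rewrite -norm2_sqr expr2 mulrC mulrA ler_wpM2r ?norm2_ge0//.
    rewrite -mulrA ler_peMr ?norm2_ge0// mulrC ler_pdivlMr// mul1r.
    exact: ry.
rewrite expr_div_n [leRHS]mulrA ler_pdivlMr ?exprn_gt0// => h.
by rewrite exprMn mulrCA mulrC.
Qed.

End Run.

(** The ratio u / v costs at most k ln q, while u exceeds D ^ k by a factor whose
    logarithm is at least 3 k ln q; and e <= 3. *)
Lemma log_ratio_le (k : nat) (u v q D : R) : 0 < D -> 0 < v -> 1 <= q ->
  u <= q ^+ k * v -> (q ^+ 3 * D) ^+ k <= u ->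
  ln u - ln v <= (expR 1)^-1 * (ln u - k%:R * ln D).
Proof.
move=> D0 v0 q1 uv Du; have q0 : 0 < q by lra.
have u0 : 0 < u by apply: lt_le_trans Du; rewrite exprn_gt0 ?mulr_gt0 ?exprn_gt0.
have l1 : ln u <= k%:R * ln q + ln v.
  apply: le_trans (_ : ln (q ^+ k * v) <= _); first by rewrite ler_ln ?posrE ?mulr_gt0 ?exprn_gt0.
  by rewrite lnM ?posrE ?exprn_gt0// lnXn// mulr_natl.
have l2 : k%:R * (3 * ln q + ln D) <= ln u.
  apply: le_trans (_ : ln ((q ^+ 3 * D) ^+ k) <= _); last first.
    by rewrite ler_ln ?posrE// exprn_gt0 ?mulr_gt0 ?exprn_gt0.
  rewrite lnXn ?mulr_gt0 ?exprn_gt0// lnM ?posrE ?exprn_gt0// lnXn//.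
  by rewrite !mulr_natl.
have lq : 0 <= k%:R * ln q by rewrite mulr_ge0 ?ler0n ?ln_ge0.
have e3 : 3^-1 <= (expR 1 : R)^-1.
  have -> : (expR 1 : R)^-1 = expR (- (1 / 6)) ^+ 6.
    by rewrite -expRN -expRM_natl; congr expR; lra.
  have h : 5 / 6 <= expR (- (1 / 6) : R).
    by apply: le_trans (expR_ge1Dx _); lra.
  apply: le_trans (_ : (5 / 6) ^+ 6 <= _); first by lra.
  by rewrite ler_pXn2r ?nnegrE ?expR_ge0//; lra.
have : 3^-1 * (ln u - k%:R * ln D) <= (expR 1)^-1 * (ln u - k%:R * ln D).
  by rewrite ler_wpM2r//; nra.
nra.
Qed.

End Perturbation.

(** * The volume lost by the greedy selection *)

Section Gap.
Variables (R : realType) (n k : nat) (X : 'M[R]_n) (Sopt : {set 'I_n}).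
Hypotheses (k0 : (0 < k)%N) (kn : (k < n)%N) (cSopt : #|Sopt| = k).
Hypothesis Smax : forall S' : {set 'I_n}, #|S'| = k ->
  vol (col_submx X S') <= vol (col_submx X Sopt).

Lemma last_nth_pivot (ys : seq 'cV[R]_n) : size ys = k -> last 0 ys = ys`_k.-1.
Proof. by move=> <-; rewrite nth_last. Qed.

Lemma ltn_predk : (k.-1 < k)%N.
Proof. by rewrite prednK. Qed.

Lemma subn_predk : (n - k.-1)%N = (n - k).+1.
Proof. by clear -k0 kn; lia. Qed.

Lemma vol_col_submxE (Z : 'M[R]_n) (S : {set 'I_n}) : #|S| = k ->
  vol (col_submx Z S) = \prod_(i < k) (singular_values (col_submx Z S))`_i.
Proof.
move=> cS; rewrite volE.
by rewrite -(big_mkord xpredT (fun i => (singular_values (col_submx Z S))`_i))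
  [X in index_iota 0 X]cS big_mkord.
Qed.

(** Pivoting on X itself, without perturbation, gives k columns whose volume is
    the product of the pivot norms; r is the smallest of these. *)
Lemma max_vol_ge : exists r : R, [/\ 0 <= r, r ^+ k <= vol (col_submx X Sopt) &
  (singular_values X)`_k.-1 <= Num.sqrt (n - k).+1%:R * r].
Proof.
have [S [T [P b]]] := bg_state_exists (X + 0) (ltnW kn).
have [f [M [ys H]]] := bg_state_pivoting b.
exists (norm2 (last 0 ys)); split; first exact: norm2_ge0.
- apply: le_trans (Smax (piv_card H)).
  have := pivoting_vol H; rewrite addr0 => ->.
  rewrite -(piv_size H) -[X in _ ^+ X]card_ord -prodr_const (big_nth 0) big_mkord.
  apply: ler_prod => i _; rewrite norm2_ge0/= (nth_pivot_ge_last H)//.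
  by rewrite -(piv_size H).
- rewrite (last_nth_pivot (piv_size H)) -subn_predk -[leRHS]addr0.
  apply: (singular_value_le_pivot H) => //; last exact: ltnW.
  + by move=> x; rewrite mul0mx norm20 mul0r.
  + exact: ltn_predk.
Qed.

Variables (D D1 : R).
Hypotheses (D0 : 0 < D) (D10 : 0 < D1).
Hypothesis hX : D * (1 + 2 ^+ k.+1 * Num.sqrt (n - k)%:R) < (singular_values X)`_k.-1.
Hypothesis hD : 47 / 10 * Num.sqrt n%:R * (2 * Num.sqrt n%:R + 3 / 2) * D1 <= D.

Let a : R := 2 ^+ k.

Lemma exp2k_ge2 : 2 <= a.
Proof. by rewrite /a -(prednK k0) exprS ler_peMr// exprn_ege1// ler1n. Qed.

Lemma sqr_sqrt2 : Num.sqrt 2%:R ^+ 2 = 2 :> R.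
Proof. by rewrite sqr_sqrtr// ler0n. Qed.

Lemma sqrt2_gt : 7 / 5 < Num.sqrt 2%:R :> R.
Proof.
rewrite ltNge; apply/negP => h.
by have := sqr_sqrt2; have := sqrtr_ge0 (2%:R : R); nra.
Qed.

Lemma sqrt2_lt : Num.sqrt 2%:R < 10 / 7 :> R.
Proof.
rewrite ltNge; apply/negP => h.
by have := sqr_sqrt2; have := sqrtr_ge0 (2%:R : R); nra.
Qed.

(** Solving the upper bound on the k-th singular value for the last pivot r; the
    factor sqrt 2 is the largest value of sqrt ((m + 1) / m) for m = n - k > 0. *)
Lemma pivot_lower_bound c r : 1 <= c -> 0 <= r ->
  (singular_values X)`_k.-1 <= Num.sqrt (n - k).+1%:R * r + c * D ->
  (2 * a - (c - 1)) * D <= Num.sqrt 2%:R * r.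
Proof.
move=> c1 r0 h; have := lt_le_trans hX h.
set s := Num.sqrt (n - k)%:R; have s1 : 1 <= s.
  by rewrite -sqrtr1 ler_wsqrtr// ler1n subn_gt0.
have bs : Num.sqrt (n - k).+1%:R <= Num.sqrt 2%:R * s.
  rewrite -sqrtrM ?ler0n// ler_wsqrtr// -natrM ler_nat.
  move: kn; rewrite -subn_gt0; case: (n - k)%N => // m _.
  by rewrite mul2n -addnn addSn addnS !ltnS leq_addr.
rewrite exprS -/a => h1.
have h2 : Num.sqrt (n - k).+1%:R * r <= Num.sqrt 2%:R * s * r by rewrite ler_wpM2r.
rewrite -(@ler_pM2l _ s); last by lra.
have h3 : (c - 1) * D <= s * ((c - 1) * D).
  by rewrite ler_peMl// mulr_ge0 ?subr_ge0// ltW.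
nra.
Qed.

Variables (E : 'M[R]_n) (nu : R) (S : {set 'I_n}).
Hypothesis hE : forall x, norm2 (E *m x) <= nu * norm2 x.
Hypothesis hnu : nu <= 8 / 5 * D.
Hypothesis hS : bg_output (X + E) k S.

Lemma norm2_col_submx (x : 'cV[R]_#|S|) :
  norm2 (col_submx (X + E) S *m x) <= norm2 (col_submx X S *m x) + nu * norm2 x.
Proof.
set g := @enum_val _ (mem S).
have ginj : injective g by exact: enum_val_inj.
have -> : col_submx (X + E) S *m x = col_submx X S *m x + E *m (sel_mx R g *m x).
  by rewrite /col_submx -!mul_sel_mx mulmxDl mulmxDl !mulmxA.
apply: le_trans (norm2D _ _) _; rewrite lerD2l.
by apply: le_trans (hE _) _; rewrite norm2_sel_mx.
Qed.

Lemma run_exists : exists T P f M ys, pivoting (X + E) S T P (f : 'I_k -> 'I_n) M ys.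
Proof.
have [T [P b]] := hS; have [f [M [ys H]]] := bg_state_pivoting b.
by exists T, P, f, M, ys.
Qed.

Lemma card_selected : #|S| = k.
Proof. by have [T [P [f [M [ys H]]]]] := run_exists; exact: piv_card H. Qed.

Lemma last_pivot_ge T P f M ys :
  pivoting (X + E) S T P (f : 'I_k -> 'I_n) M ys ->
  (2 * a - 3 / 5) * D <= Num.sqrt 2%:R * norm2 (last 0 ys).
Proof.
move=> H; have -> : 3 / 5 = 8 / 5 - 1 :> R by lra.
apply: pivot_lower_bound; [by lra|exact: norm2_ge0|].
have h := singular_value_le_pivot H hE ltn_predk (ltnW kn).
apply: le_trans h _; rewrite subn_predk (last_nth_pivot (piv_size H)).
by rewrite lerD2l.
Qed.

(** Back substitution loses a factor of about 2^k / sqrt 3 and the last pivot is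
    of order sqrt 2 * 2^k * D, so that the power of 2 cancels; the constant 7/3
    is uniform in k, close to the least value of the resulting ratio. *)
Lemma selected_well_conditioned (x : 'cV[R]_#|S|) :
  7 / 3 * D * norm2 x <= norm2 (col_submx (X + E) S *m x).
Proof.
have D0' := D0.
have [T [P [f [M [ys H]]]]] := run_exists.
set r := norm2 (last 0 ys).
have a2 := exp2k_ge2.
have r0 : 0 <= r by exact: norm2_ge0.
have h1 := last_pivot_ge H; rewrite -/r in h1.
have r_gt0 : 0 < r.
  rewrite lt_neqAle r0 andbT; apply/eqP => r00; move: h1; rewrite -r00 mulr0.
  by apply/negP; rewrite -ltNge mulr_gt0//; lra.
have h2 := norm2_selected_ge H x r_gt0; rewrite -/r in h2.
set v := norm2 (_ *m _) in h2 *; set y := norm2 x in h2 *.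
have y0 : 0 <= y by exact: norm2_ge0.
have v0 : 0 <= v by exact: norm2_ge0.
have a4 : 4 ^+ k = a ^+ 2 by rewrite /a -exprM mulnC exprM; congr (_ ^+ _); lra.
rewrite a4 in h2.
have h3 : ((2 * a - 3 / 5) * D) ^+ 2 <= 2 * r ^+ 2.
  have x0 : 0 <= (2 * a - 3 / 5) * D by apply: mulr_ge0; [lra|exact: ltW].
  have z0 : 0 <= Num.sqrt 2%:R * r by rewrite mulr_ge0 ?sqrtr_ge0.
  by rewrite -[X in _ <= X * _]sqr_sqrt2 -exprMn ler_pXn2r.
have a21 : 0 < a ^+ 2 - 1 by nra.
have l0 : 0 <= 7 / 3 * D * y by rewrite mulr_ge0//; lra.
rewrite -(@ler_pXn2r _ 2) ?nnegrE//.
rewrite -(ler_pM2l a21); apply: le_trans h2.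
rewrite !exprMn mulrA [leRHS]mulrA ler_wpM2r ?sqr_ge0//.
have h4 : 49 / 9 * (a ^+ 2 - 1) <= 3 / 2 * (2 * a - 3 / 5) ^+ 2.
  (* The quadratic in a has negative discriminant; 13/4 is near its minimum. *)
  have := sqr_ge0 (a - 13 / 4); nra.
have D20 : 0 <= D ^+ 2 by exact: sqr_ge0.
have := ler_wpM2r D20 h4; rewrite exprMn in h3; nra.
Qed.

Lemma selected_vol_ge (x : 'cV[R]_#|S|) :
  31 / 100 * norm2 (col_submx (X + E) S *m x) <= norm2 (col_submx X S *m x).
Proof.
have D0' := D0; have hnu' := hnu.
have h1 := norm2_col_submx x; have h2 := selected_well_conditioned x.
have h3 : nu * norm2 x <= 8 / 5 * D * norm2 x by rewrite ler_wpM2r ?norm2_ge0.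
have := norm2_ge0 (col_submx (X + E) S *m x); lra.
Qed.

Lemma selected_vol_gt0 : 0 < vol (col_submx X S).
Proof.
have D0' := D0.
pose c := 31 / 100 * (7 / 3 * D).
have c0 : 0 < c by rewrite /c; lra.
apply: lt_le_trans (_ : c ^+ #|S| <= _); first by rewrite exprn_gt0.
apply: vol_ge; first exact: ltW.
move=> x; apply: le_trans (selected_vol_ge x).
by have := selected_well_conditioned x; rewrite /c; lra.
Qed.

Let sqrtn_ge m : (m ^ 2 <= n)%N -> m%:R <= Num.sqrt n%:R :> R.
Proof.
move=> mn; rewrite -[m%:R]ger0_norm ?ler0n// -sqrtr_sqr ler_wsqrtr//.
by rewrite -natrX ler_nat.
Qed.

Let sn2 : Num.sqrt n%:R ^+ 2 = n%:R :> R. Proof. by rewrite sqr_sqrtr// ler0n. Qed.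

Lemma cube_le_4exp j : (2 * j.+2 ^ 3 <= 4 ^ j.+2)%N.
Proof.
elim: j => // j IH; rewrite [(4 ^ _)%N]expnS.
have : (4 * (2 * j.+2 ^ 3) <= 4 * 4 ^ j.+2)%N by rewrite leq_mul2l.
apply: leq_trans; rewrite !expnS !expn0; nia.
Qed.

(** Every singular value of the optimal submatrix is at most sqrt k times the
    corresponding pivot, up to the perturbation, so that greedy selection loses
    at most a factor of order sqrt k per column.  The maximal volume itself is
    at least (sqrt 2 * 2^k * D)^k, which dominates any fixed power of k. *)
Lemma vol_ratio_large : (1 < k)%N -> exists2 q : R, 1 <= q &
  vol (col_submx X Sopt) <= q ^+ k * vol (col_submx X S) /\
  (q ^+ 3 * D1) ^+ k <= vol (col_submx X Sopt).
Proof.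
have D0' := D0; have D10' := D10; have hD' := hD; have hnu' := hnu.
move=> k1; have [T [P [f [M [ys H]]]]] := run_exists.
set r := norm2 (last 0 ys).
have a2 := exp2k_ge2; have s2gt := sqrt2_gt; have s2lt := sqrt2_lt.
have r0 : 0 <= r by exact: norm2_ge0.
have a4 : 4 <= a.
  rewrite /a; move: k1; case: k => [|[|j]]// _.
  by rewrite !exprS mulrA (_ : 2 * 2 = 4) ?ler_peMr ?exprn_ege1 ?ler1n//; lra.
have h1 := last_pivot_ge H; rewrite -/r in h1.
set sk := Num.sqrt k%:R : R.
have sk2 : Num.sqrt 2%:R <= sk by rewrite ler_wsqrtr// ler_nat.
have skk : sk ^+ 2 = k%:R by rewrite sqr_sqrtr ?ler0n.
have nur : nu <= 23 / 100 * sk * r.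
  have h2 : 74 / 10 * D <= (2 * a - 3 / 5) * D by apply: ler_wpM2r; [exact: ltW|lra].
  have h3 : Num.sqrt 2%:R * r <= 10 / 7 * r by rewrite ler_wpM2r// ltW.
  have h4 : 7 / 5 * r <= sk * r by rewrite ler_wpM2r//; lra.
  lra.
(* The pivots lose 123/100 sk against Xopt, and X_S loses 31/100 against the
   pivots; 123/100 is less than 4 * 31/100. *)
exists (4 * sk); first by lra.
have vZ := pivoting_vol H.
split.
  have vX : (31 / 100) ^+ k * vol (col_submx (X + E) S) <= vol (col_submx X S).
    rewrite -[in _ ^+ k]card_selected; apply: vol_le; first by lra.
    exact: selected_vol_ge.
  have vO : vol (col_submx X Sopt) <= (123 / 100 * sk) ^+ k * vol (col_submx (X + E) S).
    rewrite (vol_col_submxE _ cSopt) vZ (big_nth 0) (piv_size H) big_mkord.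
    rewrite -[X in _ ^+ X]card_ord -prodr_const -big_split/=.
    apply: ler_prod => i _; rewrite singular_values_ge0/=.
    have ik : (i < k)%N by [].
    have iS : (i < #|Sopt|)%N by rewrite cSopt.
    have := singular_value_sel_le_pivot H hE ik iS (@enum_val_inj _ (mem Sopt)).
    rewrite -/(col_submx X Sopt) [X in Num.sqrt X%:R]cSopt -/sk => h.
    have h2 := nth_pivot_ge_last H ik; rewrite -/r in h2.
    have : sk * r <= sk * norm2 ys`_i by rewrite ler_wpM2l ?sqrtr_ge0.
    lra.
  apply: le_trans vO _.
  have h5 : (123 / 100 * sk) ^+ k <= (4 * sk) ^+ k * (31 / 100) ^+ k.
    by rewrite -exprMn ler_pXn2r ?nnegrE//; lra.
  apply: le_trans (_ : (4 * sk) ^+ k * (31 / 100) ^+ k * vol (col_submx (X + E) S) <= _).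
    by rewrite ler_wpM2r ?vol_ge0.
  by rewrite -mulrA ler_wpM2l// exprn_ge0//; lra.
have [rX [rX0 rXv hs]] := max_vol_ge.
apply: le_trans rXv; rewrite ler_pXn2r ?nnegrE//; last first.
  by rewrite mulr_ge0 ?exprn_ge0 ?ltW//; lra.
have h6 : 2 * a * D <= Num.sqrt 2%:R * rX.
  have := @pivot_lower_bound 1 rX (lexx _) rX0.
  rewrite subrr subr0; apply; apply: le_trans hs _.
  by rewrite lerDl mul1r ltW.
have n3 : (3 <= n)%N by apply: leq_ltn_trans kn.
have sn1 : 1 <= Num.sqrt n%:R :> R by apply: (sqrtn_ge (m := 1)); apply: leq_trans n3.
(* 35 is below the coefficient of D1 in hD for n = 3, and q^3 is 64 k sk, where
   sqrt 2 * k sk <= a; it suffices that 64 <= 2 * 35. *)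
have h7 : 35 * D1 <= D.
  apply: le_trans hD; apply: ler_wpM2r; first exact: ltW.
  have n3R : 3 <= n%:R :> R by rewrite ler_nat.
  have := sn2; nra.
have ksk : 2 * (k%:R * sk) ^+ 2 <= a ^+ 2.
  rewrite exprMn skk -exprSr /a -exprM mulnC exprM -!natrX -natrM ler_nat.
  by move: k1; case: k => [|[|j]]// _; exact: cube_le_4exp.
have h8 : Num.sqrt 2%:R * (k%:R * sk) <= a.
  rewrite -(@ler_pXn2r _ 2) ?nnegrE ?mulr_ge0 ?sqrtr_ge0 ?ler0n//; last by lra.
  by rewrite exprMn sqr_sqrt2.
have -> : (4 * sk) ^+ 3 = 64 * (k%:R * sk).
  by rewrite -skk; field.
set u := k%:R * sk in h8 ksk *.
have u0 : 0 <= u by rewrite mulr_ge0 ?sqrtr_ge0 ?ler0n.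
have s20 : 0 < Num.sqrt 2%:R :> R by lra.
rewrite -(ler_pM2l s20).
apply: le_trans h6.
have h9 : Num.sqrt 2%:R * u * D1 <= a * D1 by apply: ler_wpM2r => //; exact: ltW.
have h10 : a * (35 * D1) <= a * D by rewrite ler_wpM2l//; lra.
nra.
Qed.

(** For one column the volume is a norm: the selected column is shorter than the
    longest one by at most twice the perturbation.  The longest one has length
    at least D (1 + 4 sqrt (n - 1)) / sqrt n.  That is 4 D or more for n > 4, but
    only about 3.5 D at n = 2, of which twice 8/5 D would leave too little. *)
Lemma vol_ratio1 : k = 1%N -> ((n <= 4)%N -> nu <= 13 / 10 * D) ->
  exists2 q : R, 1 <= q &
  vol (col_submx X Sopt) <= q ^+ k * vol (col_submx X S) /\
  (q ^+ 3 * D1) ^+ k <= vol (col_submx X Sopt).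
Proof.
have D0' := D0; have D10' := D10; have hD' := hD; have hnu' := hnu.
move=> k1 hnu4; have [T [P [f [M [ys H]]]]] := run_exists.
set r := norm2 (last 0 ys); set s := vol (col_submx X Sopt).
have r0 : 0 <= r by exact: norm2_ge0.
have cS := card_selected.
have szys : size ys = 1%N by rewrite (piv_size H).
have vZ : vol (col_submx (X + E) S) = r.
  by rewrite (pivoting_vol H) /r; case: ys szys {H r r0} => [|y []]//= _; rewrite big_seq1.
have lr : norm2 ys`_0 = r by rewrite /r; case: ys szys {H r r0 vZ} => [|y []].
have sr : s <= r + nu.
  rewrite /s (vol_col_submxE _ cSopt) k1 big_ord1.
  have i0 : (0 < #|Sopt|)%N by rewrite cSopt.
  have := singular_value_sel_le_pivot H hE k0 i0 (@enum_val_inj _ (mem Sopt)).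
  by rewrite -/(col_submx X Sopt) [X in Num.sqrt X%:R]cSopt k1 sqrtr1 mul1r lr.
have sX : s - 2 * nu <= vol (col_submx X S).
  have [h|h] := leP (s - 2 * nu) 0; first by rewrite (le_trans h)// vol_ge0.
  have -> : s - 2 * nu = (s - 2 * nu) ^+ #|S| by rewrite cS k1 expr1.
  apply: vol_ge; first exact: ltW.
  move=> x; have h1 := norm2_col_submx x.
  have h2 := norm2_ge_singular_value_last (col_submx (X + E) S) x.
  have h3 : (singular_values (col_submx (X + E) S))`_#|S|.-1 = r.
    by rewrite -vZ (vol_col_submxE _ cS) [in RHS]k1 big_ord1 [X in X.-1]cS k1.
  rewrite h3 in h2.
  have : (s - 2 * nu) * norm2 x <= (r - nu) * norm2 x.
    by rewrite ler_wpM2r ?norm2_ge0//; lra.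
  lra.
have [rX [rX0 rXv hs]] := max_vol_ge.
have m1 : n = (n - k).+1 by clear -kn k1; lia.
move: hX hs rXv; rewrite -m1 -/s k1 expr1 (_ : 2 ^+ 2 = 4); last by lra.
set t := Num.sqrt (n - 1)%:R => h1 h2 h3.
have n2 : (2 <= n)%N by rewrite -k1.
have t2 : t ^+ 2 = n%:R - 1 by rewrite sqr_sqrtr ?ler0n// natrB// -k1 ltnW.
have t1 : 1 <= t by rewrite -sqrtr1 ler_wsqrtr// ler1n subn_gt0.
set z := Num.sqrt n%:R in h2 hD'.
have z2 : z ^+ 2 = t ^+ 2 + 1 by rewrite /z sn2 t2; lra.
have z1 : 1 <= z by rewrite /z; apply: (sqrtn_ge (m := 1)); apply: leq_trans n2.
have zs : D * (1 + 4 * t) <= z * s.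
  apply: le_trans (ltW (lt_le_trans h1 h2)) _; rewrite ler_wpM2l//; lra.
have D1z : 47 / 10 * (2 * z ^+ 2 + 3 / 2 * z) * D1 <= D by move: hD'; lra.
have nE : n%:R = z ^+ 2 :> R by rewrite /z sn2.
have [n4|n4] := leqP n 4; last first.
  have n5 : 5 <= z ^+ 2 by rewrite -nE ler_nat.
  have tge2 : 2 <= t by rewrite -(@ler_pXn2r _ 2) ?nnegrE//; lra.
  have zt : 4 * z <= 1 + 4 * t.
    by rewrite -(@ler_pXn2r _ 2) ?nnegrE//; [rewrite exprMn z2; lra|lra|lra].
  have s4 : 4 * D <= s.
    have z0 : 0 < z by lra.
    rewrite -(ler_pM2l z0); apply: le_trans zs.
    have : D * (4 * z) <= D * (1 + 4 * t) by rewrite ler_wpM2l// ltW.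
    lra.
  (* s <= 5 (s - 16/5 D) because s >= 4 D, and 5^3 <= 4 * 47. *)
  exists 5; first by lra.
  rewrite expr1 expr1; split; first by lra.
  have : (47 / 10 * 10) * D1 <= 47 / 10 * (2 * z ^+ 2 + 3 / 2 * z) * D1.
    by apply: ler_wpM2r; [exact: ltW|lra].
  by lra.
have hnu2 := hnu4 n4.
have zt : 35 / 10 * z <= 1 + 4 * t.
  by rewrite -(@ler_pXn2r _ 2) ?nnegrE//; [rewrite exprMn z2; nra|lra|lra].
have s4 : 35 / 10 * D <= s.
  have z0 : 0 < z by lra.
  rewrite -(ler_pM2l z0); apply: le_trans zs.
  have : D * (35 / 10 * z) <= D * (1 + 4 * t) by rewrite ler_wpM2l// ltW.
  lra.
(* s <= 39/10 (s - 13/5 D) because s >= 7/2 D, and (39/10)^3 <= 7/2 * 94/5. *)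
exists (39 / 10); first by lra.
rewrite expr1 expr1; split; first by lra.
have z22 : 2 <= z ^+ 2 by rewrite -nE ler_nat.
have : (47 / 10 * 4) * D1 <= 47 / 10 * (2 * z ^+ 2 + 3 / 2 * z) * D1.
  by apply: ler_wpM2r; [exact: ltW|lra].
lra.
Qed.

End Gap.

(** * Integration against an image of a density *)

Section Transfer.
Import HBNNSimple.
Local Open Scope ereal_scope.
Context d1 d2 (T1 : measurableType d1) (T2 : measurableType d2) (R : realType).
Variables (mu : {measure set T1 -> \bar R}) (nu : {measure set T2 -> \bar R}).
Variables (phi : T1 -> T2) (F : T1 -> R).
Hypotheses (mphi : measurable_fun setT phi) (mF : measurable_fun setT F).
Hypothesis F0 : forall x, (0 <= F x)%R.
Hypothesis nuE : forall A, measurable A ->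
  nu A = \int[mu]_(x in phi @^-1` A) (F x)%:E.

Lemma measurable_phi A : measurable A -> measurable (phi @^-1` A).
Proof. by move=> mA; rewrite -[phi @^-1` A]setTI; exact: mphi. Qed.

Lemma nnsfun_integral_transfer (g : {nnsfun T2 >-> R}) :
  \int[nu]_y (g y)%:E = \int[mu]_x (g (phi x) * F x)%:E.
Proof.
pose B r := phi @^-1` (g @^-1` [set r]).
have mB r : measurable (B r) by exact: measurable_phi.
transitivity (\int[mu]_x (\sum_(r \in range g) (r * (\1_(B r) x * F x))%:E)); last first.
  apply: eq_integral => x _; rewrite fsumEFin//; congr EFin.
  rewrite (fsbigD1 (g (phi x)))//=; last by exists (phi x).
  rewrite indicE mem_set// mul1r fsbig1 ?addr0//.
  by move=> r [_ /= gr]; rewrite indicE memNset ?mul0r ?mulr0// => /esym.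
rewrite ge0_integral_fsum//; last 2 first.
- move=> r; apply/measurable_EFinP; apply: measurable_funM => //.
  by apply: measurable_funM => //; exact: measurable_indic.
- move=> r x _; rewrite lee_fin indicE; have [/set_mem <-|_] := boolP (x \in B r).
    by rewrite !mulr_ge0.
  by rewrite mul0r mulr0.
rewrite integralT_nnsfun sintegralE; apply: eq_fsbigr => r /[!inE] -[y _ <-].
rewrite nuE// -/(B (g y)).
under [RHS]eq_integral do rewrite EFinM.
rewrite ge0_integralZl_EFin//; last 2 first.
- by move=> x _; rewrite lee_fin mulr_ge0.
- by apply/measurable_EFinP; apply: measurable_funM => //; exact: measurable_indic.
congr (_ * _); rewrite [LHS]integral_mkcond; apply: eq_integral => x _.
by rewrite epatch_indic/= EFinM muleC.
Qed.

(** Covers both a law with a density (phi = id) and the integration of one random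
    variable phi out of a product, where F collects the other factors. *)
Lemma ge0_integral_transfer (h : T2 -> R) : measurable_fun setT h ->
  (forall y, (0 <= h y)%R) ->
  \int[nu]_y (h y)%:E = \int[mu]_x (h (phi x) * F x)%:E.
Proof.
move=> mh h0; have mh' : measurable_fun setT (EFin \o h) by exact/measurable_EFinP.
pose g := nnsfun_approx measurableT mh'.
have gcvg y : (g n y)%:E @[n --> \oo] --> (h y)%:E.
  by apply: (@cvg_nnsfun_approx _ _ _ _ measurableT (EFin \o h) mh') => // z _; rewrite lee_fin.
have gnd y : {homo (fun n => g n y) : m n / (m <= n)%N >-> (m <= n)%R}.
  by move=> m n mn; exact/lefP/nd_nnsfun_approx.
transitivity (limn (fun n => \int[nu]_y (g n y)%:E)).
  rewrite -monotone_convergence//.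
  - by apply: eq_integral => y _; apply/esym/cvg_lim.
  - by move=> n; exact/measurable_EFinP.
  - by move=> n y _; rewrite lee_fin.
  - by move=> y _ m n mn; rewrite lee_fin gnd.
transitivity (limn (fun n => \int[mu]_x (g n (phi x) * F x)%:E)).
  by congr (limn _); apply/funext => n; exact: nnsfun_integral_transfer.
rewrite -monotone_convergence//.
- apply: eq_integral => x _; apply/cvg_lim => //.
  under eq_fun do rewrite EFinM.
  by rewrite EFinM; apply: cvgeZr.
- move=> n; apply/measurable_EFinP; apply: measurable_funM => //.
  exact: measurableT_comp.
- by move=> n x _; rewrite lee_fin mulr_ge0.
- by move=> x _ m n mn; rewrite lee_fin ler_wpM2r// gnd.
Qed.

End Transfer.

(** * Products of independent random variables *)

Section Independence.
Local Open Scope ereal_scope.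
Context d (Omega : measurableType d) (R : realType) (P : probability Omega R).
Variables (I : finType) (X : I -> {RV P >-> R}).
Hypothesis indep : mutually_independent X.

(** The variables outside s constrained to lie in given sets, the form in which
    the product rule is still available for them. *)
Definition off_event (s : seq I) (A : I -> set R) : set Omega :=
  \bigcap_(i in [set i | i \notin s]) X i @^-1` A i.

Lemma measurable_RV_preimage i (B : set R) : measurable B ->
  measurable (X i @^-1` B).
Proof. by move=> mB; rewrite -[_ @^-1` _]setTI; exact: measurable_funP. Qed.

Lemma measurable_off_event s A : (forall i, measurable (A i)) ->
  measurable (off_event s A).
Proof.
move=> mA; apply: fin_bigcap_measurable; first exact: finite_finset.
by move=> i _; exact: measurable_RV_preimage.
Qed.

Variables (g : I -> R -> R) (c : I -> R).
Hypotheses (mg : forall i, measurable_fun setT (g i)).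
Hypothesis g0 : forall i x, (0 <= g i x)%R.
Hypothesis gc : forall i, \int[P]_w (g i (X i w))%:E = (c i)%:E.

Lemma c_ge0 i : (0 <= c i)%R.
Proof. by rewrite -lee_fin -gc integral_ge0// => w _; rewrite lee_fin. Qed.

Lemma measurable_prod_RV s : measurable_fun setT (fun w => \prod_(i <- s) g i (X i w))%R.
Proof.
apply: measurable_prod => i _.
by apply: measurableT_comp; [exact: mg|exact: measurable_funP].
Qed.

(** The coordinates are integrated out one at a time: as a function of the set
    in which X j is required to fall, the partial integral is a measure
    proportional to the law of X j. *)
Lemma integral_prod_off_event s A : uniq s -> (forall i, measurable (A i)) ->
  \int[P]_(w in off_event s A) (\prod_(i <- s) g i (X i w))%:E =
  (\prod_(i <- s) c i * \prod_(i | i \notin s) fine (P (X i @^-1` A i)))%:E.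
Proof.
elim: s A => [|j s IH] A.
  move=> _ mA; under eq_integral do rewrite big_nil.
  rewrite big_nil mul1r integral_cst ?mul1e; last exact: measurable_off_event.
  have -> : off_event [::] A = \bigcap_(i in [set i | i \in [set: I]%SET]) X i @^-1` A i.
    by rewrite /off_event; congr bigcap; apply/seteqP; split => i /=; rewrite inE.
  apply: etrans (indep [set: I]%SET mA) _.
  rewrite -prodEFin; apply: eq_big => [i|i _]; first by rewrite inE.
  by rewrite fineK// fin_num_measure//; exact: measurable_RV_preimage.
move=> /= /andP[js us] mA.
pose B := off_event (j :: s) A.
have mB : measurable B by exact: measurable_off_event.
pose F w := (\1_B w * \prod_(i <- s) g i (X i w))%R.
pose K := (\prod_(i <- s) c i * \prod_(i | i \notin j :: s) fine (P (X i @^-1` A i)))%R.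
have K0 : (0 <= K)%R.
  by rewrite mulr_ge0//; apply: prodr_ge0 => i _; [exact: c_ge0|exact: fine_ge0].
have nuE C : measurable C ->
    mscale (NngNum K0) (distribution P (X j)) C = \int[P]_(w in X j @^-1` C) (F w)%:E.
  move=> mC; rewrite /mscale/= /distribution/= /pushforward.
  pose A' i := if i == j then C else A i.
  have mA' i : measurable (A' i) by rewrite /A'; case: ifP.
  transitivity (\int[P]_(w in off_event s A') (\prod_(i <- s) g i (X i w))%:E).
    have prodA' : (\prod_(i | i \notin s) fine (P (X i @^-1` A' i)) =
        fine (P (X j @^-1` C)) *
        \prod_(i | i \notin j :: s) fine (P (X i @^-1` A i)))%R.
      rewrite (bigD1 j)//= /A' eqxx; congr (_ * _)%R; apply: eq_big => [i|i].
        by rewrite inE negb_or andbC.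
      by move=> /andP[_ /negbTE ->].
    rewrite IH// prodA' mulrCA [RHS]EFinM -/K [RHS]muleC fineK//.
    by rewrite fin_num_measure//; exact: measurable_RV_preimage.
  have -> : off_event s A' = (X j @^-1` C) `&` B.
    apply/seteqP; split => [w sw|w [jw Bw] i /= is_].
      split; first by have := sw j js; rewrite /A' eqxx.
      move=> i /=; rewrite inE negb_or => /andP[/negbTE ij is_].
      by have := sw i is_; rewrite /A' ij.
    rewrite /A'; case: ifPn => [/eqP->//|ij].
    by apply: Bw => /=; rewrite inE negb_or ij.
  rewrite integral_mkcondr; apply: eq_integral => w _.
  by rewrite epatch_indic/= /F EFinM muleC.
have mF : measurable_fun setT F.
  apply: measurable_funM; first exact: measurable_indic.
  exact: measurable_prod_RV.
have F0 w : (0 <= F w)%R by rewrite mulr_ge0// prodr_ge0.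
have := ge0_integral_transfer (measurable_funP (X j)) mF F0 nuE (mg j) (@g0 j).
rewrite ge0_integral_mscale//; last 2 first.
- exact/measurable_EFinP.
- by move=> x _; rewrite lee_fin.
rewrite ge0_integral_distribution//; last 2 first.
- exact/measurable_EFinP.
- by move=> x; rewrite lee_fin.
rewrite gc/= => h; transitivity (K%:E * (c j)%:E); last first.
  by rewrite -EFinM /K big_cons mulrC mulrA.
rewrite h [LHS]integral_mkcond; apply: eq_integral => w _.
rewrite epatch_indic/= -EFinM big_cons /F; congr EFin.
by rewrite mulrC mulrCA.
Qed.

Lemma integral_prod_indep :
  \int[P]_w (\prod_i g i (X i w))%:E = (\prod_i c i)%:E.
Proof.
have := @integral_prod_off_event (index_enum I) (fun=> setT)
  (index_enum_uniq _) (fun=> measurableT).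
have -> : off_event (index_enum I) (fun=> setT) = setT.
  by apply/seteqP; split => // w _ i /=; rewrite mem_index_enum.
move=> ->; rewrite [X in (_ * X)%R]big1 ?mulr1// => i.
by rewrite mem_index_enum.
Qed.

End Independence.

(** * Simultaneous tail bounds for Gaussian linear forms *)

Section GaussianTail.
Local Open Scope ereal_scope.
Context d (Omega : measurableType d) (R : realType) (P : probability Omega R).

Definition standard_normal (X : {RV P >-> R}) :=
  forall A : set R, measurable A -> distribution P X A = normal_prob 0%R 1%R A.

(** Completing the square: exp (t x) shifts the mean of the density to t. *)
Lemma standard_normal_mgf (X : {RV P >-> R}) t : standard_normal X ->
  \int[P]_w (expR (t * X w))%:E = (expR (t ^+ 2 / 2))%:E.
Proof.
move=> hX; have mt : measurable_fun setT (fun x : R => expR (t * x)).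
  by apply: measurableT_comp => //; exact: measurable_funM.
transitivity (\int[distribution P X]_x (expR (t * x))%:E).
  by rewrite ge0_integral_distribution//; exact/measurable_EFinP.
have -> : \int[distribution P X]_x (expR (t * x))%:E =
    \int[@lebesgue_measure R]_x (expR (t * id x) * normal_pdf 0 1 x)%:E.
  have H := @ge0_integral_transfer _ _ _ _ R (@lebesgue_measure R)
    (distribution P X) id (normal_pdf 0 1).
  apply: H => //.
  - exact: measurable_normal_pdf.
  - by move=> x; exact: normal_pdf_ge0.
transitivity (\int[@lebesgue_measure R]_x ((expR (t ^+ 2 / 2))%:E * (normal_pdf t 1 x)%:E)).
  apply: eq_integral => x _; rewrite -EFinM; congr EFin.
  rewrite !normal_pdfE ?oner_neq0// /normal_fun.
  rewrite mulrCA [RHS]mulrCA; congr (_ * _)%R; rewrite -!expRD; congr expR.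
  by rewrite expr1n mulr2n; field.
rewrite ge0_integralZl_EFin ?expR_ge0//; last 2 first.
- by move=> x _; rewrite lee_fin normal_pdf_ge0.
- by apply/measurable_EFinP; exact: measurable_normal_pdf.
by rewrite integral_normal_pdf mule1.
Qed.

Lemma linear_form_mgf (I : finType) (X : I -> {RV P >-> R}) (a : I -> R) :
  mutually_independent X -> (forall i, standard_normal (X i)) ->
  \int[P]_w (expR (\sum_i a i * X i w))%:E = (expR (\sum_i a i ^+ 2 / 2))%:E.
Proof.
move=> indep hX; under eq_integral do rewrite expR_sum.
rewrite (@integral_prod_indep _ _ _ _ _ _ indep
  (fun i x => expR (a i * x))%R (fun i => expR (a i ^+ 2 / 2)))//.
- by rewrite expR_sum.
- by move=> i; apply: measurableT_comp => //; exact: measurable_funM.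
- by move=> i; exact: standard_normal_mgf.
Qed.

(** Markov's inequality for the sum over k of exp (form k - b k): where that sum is
    at most 1, so is each of its terms. *)
Lemma gaussian_forms_tail (I K : finType) (X : I -> {RV P >-> R})
    (a : K -> I -> R) (b : K -> R) (p : R) :
  mutually_independent X -> (forall i, standard_normal (X i)) ->
  (\sum_k expR (\sum_i a k i ^+ 2 / 2 - b k) <= p)%R ->
  exists A : set Omega, [/\ measurable A, (1 - p)%:E <= P A &
    forall w, A w -> forall k, (\sum_i a k i * X i w <= b k)%R].
Proof.
move=> indep hX hp.
pose Y k w := expR (\sum_i a k i * X i w - b k).
have mY k : measurable_fun setT (Y k).
  apply: measurableT_comp => //; apply: measurable_funB => //.
  by apply: measurable_sum => i; apply: measurable_funM => //; exact: measurable_funP.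
pose S w := (\sum_k Y k w)%R.
have mS : measurable_fun setT S by exact: measurable_sum.
have Y0 k w : (0 <= Y k w)%R by exact: expR_ge0.
pose B := [set w | (1 < S w)%R].
have mB : measurable B.
  have -> : B = S @^-1` `]1%R, +oo[ by apply/seteqP; split => w /=; rewrite in_itv/= andbT.
  by rewrite -[_ @^-1` _]setTI; exact: mS.
have PB : P B <= p%:E.
  have -> : P B = \int[P]_w (\1_B w)%:E by rewrite integral_indic// setIT.
  apply: (@le_trans _ _ (\int[P]_w (S w)%:E)).
    apply: ge0_le_integral => //.
    - by apply/measurable_EFinP; exact: measurable_indic.
    - exact/measurable_EFinP.
    - move=> w _; rewrite lee_fin indicE; have [/set_mem h|_] := boolP (w \in B).
        by rewrite ltW.
      by rewrite sumr_ge0.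
  under eq_integral do rewrite -sumEFin.
  rewrite ge0_integral_sum//; last 2 first.
  - by move=> k; exact/measurable_EFinP.
  - by move=> k w _; rewrite lee_fin.
  rewrite -lee_fin in hp; apply: le_trans hp; rewrite -sumEFin.
  apply: lee_sum => k _; under eq_integral do rewrite /Y expRD EFinM muleC.
  rewrite ge0_integralZl_EFin ?expR_ge0//; last first.
    apply/measurable_EFinP; apply: measurableT_comp => //.
    by apply: measurable_sum => i; apply: measurable_funM => //; exact: measurable_funP.
  by rewrite linear_form_mgf// -EFinM mulrC -expRD.
exists (~` B); split.
- exact: measurableC.
- by rewrite probability_setC// EFinB leeB.
- move=> w; rewrite /B/= => /negP; rewrite -leNgt => Sw k.
  have : (Y k w <= 1)%R.
    by apply: le_trans Sw; rewrite /S (bigD1 k)//= lerDl sumr_ge0.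
  by rewrite /Y -[leRHS]expR0 ler_expR subr_le0.
Qed.

End GaussianTail.

(** * Rounding to lattice points *)

Section Lattice.
Variables (R : realType) (N : nat).

(** The integers of absolute value at most N, each exactly once: j + 1, - (j + 1)
    and 0. *)
Definition lattice_pt : finType := ('I_N + 'I_N + unit)%type.

Definition lattice_val (i : lattice_pt) : R :=
  match i with
  | inl (inl j) => j.+1%:R
  | inl (inr j) => - j.+1%:R
  | inr _ => 0
  end.

Lemma lattice_val_surj (z : int) : `|z| <= N%:Z -> exists i, lattice_val i = z%:~R.
Proof.
case: z => [[|j]|j] h.
- by exists (inr tt).
- have jN : (j < N)%N by lia.
  by exists (inl (inl (Ordinal jN))).
- have jN : (j < N)%N by lia.
  by exists (inl (inr (Ordinal jN))); rewrite /= NegzE mulrNz.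
Qed.

Lemma expR_half_ge : 81 / 50 <= expR 2^-1 :> R.
Proof.
have -> : (2^-1 : R) = 8%:R * (1 / 16) by lra.
rewrite expRM_natl; apply: le_trans (_ : (17 / 16) ^+ 8 <= _); first by lra.
rewrite ler_pXn2r ?nnegrE ?expR_ge0//.
by apply: le_trans (expR_ge1Dx _); lra.
Qed.

(** Since j^2 >= 3 j - 2, the theta series is at most 1 + 2 q / (1 - q^3) with
    q = exp (- 1/2), which is less than e. *)
Lemma lattice_weight : \sum_(i : lattice_pt) expR (- (lattice_val i ^+ 2 / 2)) <= expR 1.
Proof.
set q : R := expR (- 2^-1); set r : R := expR 2^-1.
have r1 : 81 / 50 <= r by exact: expR_half_ge.
have qr : q = r^-1 by rewrite /q expRN.
have rr : expR 1 = r ^+ 2 by rewrite /r -expRM_natl; congr expR; lra.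
have q0 : 0 < q by exact: expR_gt0.
have q31 : q ^+ 3 < 1.
  by rewrite expr_lt1 ?ltW// qr invf_lt1; lra.
have half : \sum_(j < N) expR (- (j.+1%:R ^+ 2 / 2)) <= q / (1 - q ^+ 3) :> R.
  apply: le_trans (_ : \sum_(j < N) q * (q ^+ 3) ^+ j <= _).
    apply: ler_sum => j _; rewrite -exprM -exprS -expRM_natl ler_expR.
    rewrite mulrN lerN2 ler_pM2r ?invr_gt0// -natrX ler_nat.
    by case: (j : nat) => // i; nia.
  rewrite -mulr_sumr ler_pM2l// -[leRHS]mul1r ler_pdivlMr ?subr_gt0//.
  have : (q ^+ 3) ^+ N - 1 = (q ^+ 3 - 1) * \sum_(j < N) (q ^+ 3) ^+ j by rewrite subrX1.
  have : 0 <= (q ^+ 3) ^+ N by rewrite !exprn_ge0// ltW.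
  lra.
have sum_unit (F : unit -> R) : \sum_i F i = F tt by rewrite (big_pred1 tt)// => -[].
rewrite !big_sumType/= sum_unit.
under [X in _ + X + _]eq_bigr do rewrite sqrrN.
rewrite expr0n/= mul0r oppr0 expR0 rr.
have r2 : 262 / 100 <= r ^+ 2 by nra.
have r3 : 424 / 100 <= r ^+ 3 by rewrite exprS; nra.
have rI : q / (1 - q ^+ 3) = r ^+ 2 / (r ^+ 3 - 1).
  by rewrite qr; field; apply/andP; split; rewrite gt_eqF//; lra.
rewrite rI in half; apply: le_trans (_ : r ^+ 2 / (r ^+ 3 - 1) + r ^+ 2 / (r ^+ 3 - 1) + 1 <= _).
  by rewrite lerD2r; exact: lerD.
rewrite -lerBrDr -mulrDl ler_pdivrMr; last by lra.
nra.
Qed.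

(** If s = f + p with f its floor, the average of the right hand side over f and
    f + 1 with weights 1 - p and p is b s - gam s^2 - gam p (1 - p). *)
Lemma round_coord (b gam s : R) : 0 <= gam -> `|s| + 1 <= N%:R ->
  exists i, b * s - gam * s ^+ 2 - gam / 4 <= b * lattice_val i - gam * lattice_val i ^+ 2.
Proof.
move=> g0 sN; pose f := Num.floor s.
have f1 : f%:~R <= s by exact: floor_le.
have f2 : s < f%:~R + 1 by rewrite -intrD1; exact: lt_succ_floor.
have sl : - `|s| <= s by rewrite lerNl ler_normr lexx orbT.
have sr : s <= `|s| by exact: ler_norm.
have fN z : f%:~R <= z%:~R :> R -> z%:~R <= f%:~R + 1 :> R -> `|z| <= N%:Z.
  move=> z1 z2; rewrite -(ler_int R) intr_norm ler_norml.
  have -> : (N%:Z)%:~R = N%:R :> R by rewrite -pmulrn.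
  by apply/andP; split; lra.
have [i iE] : exists i, lattice_val i = f%:~R by apply/lattice_val_surj/fN; rewrite ?lexx ?lerDl.
have [j jE] : exists i, lattice_val i = (f + 1)%:~R.
  by apply/lattice_val_surj/fN; rewrite intrD; lra.
rewrite intrD in jE.
set c := b * s - _ - _.
have [ci|ci] := leP c (b * lattice_val i - gam * lattice_val i ^+ 2); first by exists i.
exists j; rewrite leNgt; apply/negP => cj.
rewrite iE in ci; rewrite jE in cj.
move: ci cj f1 f2; rewrite /c; set F : R := f%:~R; move=> ci cj f1 f2.
have := sqr_ge0 (s - F - 1 / 2) => h.
have : gam * (s - F - 1 / 2) ^+ 2 >= 0 by rewrite mulr_ge0.
have h1 : 0 <= s - F by lra.
have h2 : 0 < 1 - (s - F) by lra.
have e1 := ltr_pM2l h2; rewrite -e1 in ci.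
have := ler_wpM2l h1 (ltW cj).
nra.
Qed.

Variable n : nat.

Definition lattice_vec (m : {ffun 'I_n -> lattice_pt}) : 'cV[R]_n :=
  \col_i lattice_val (m i).

(** A quadratic penalty is separable, so rounding each coordinate up or down,
    whichever is better, costs at most gam / 4 per coordinate. *)
Lemma round_vec (b x : 'cV[R]_n) alpha gam : 0 <= gam ->
  (forall i, `|x i 0| + 1 <= N%:R) ->
  (forall m, dot b (lattice_vec m) <= alpha + gam * norm2 (lattice_vec m) ^+ 2) ->
  dot b x <= alpha + gam * (norm2 x ^+ 2 + n%:R / 4).
Proof.
move=> g0 xN hb.
have [m hm] := boolp.choice (fun i => round_coord (b i 0) g0 (xN i)).
have := hb [ffun i => m i].
rewrite !dotE !norm2_sum_sqr => h.
have : \sum_i (b i 0 * x i 0 - gam * x i 0 ^+ 2 - gam / 4) <=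
   \sum_i (b i 0 * lattice_val (m i) - gam * lattice_val (m i) ^+ 2).
  by apply: ler_sum => i _; exact: hm.
rewrite !sumrB sumr_const card_ord -!mulr_sumr -mulr_natl.
move: h; under eq_bigr do rewrite mxE ffunE.
under [in X in _ <= X -> _]eq_bigr do rewrite mxE ffunE.
lra.
Qed.

(** Rounding x with y' a lattice point, then y with x arbitrary. *)
Lemma round_bilinear (A : 'M[R]_n) mu C (x y : 'cV[R]_n) :
  (forall i, `|x i 0| + 1 <= N%:R) -> (forall i, `|y i 0| + 1 <= N%:R) ->
  (forall m m', mu * dot (lattice_vec m) (A *m lattice_vec m') <=
     mu ^+ 2 / 2 * (norm2 (lattice_vec m) ^+ 2 * norm2 (lattice_vec m') ^+ 2) +
     norm2 (lattice_vec m) ^+ 2 / 2 + norm2 (lattice_vec m') ^+ 2 / 2 + C) ->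
  mu * dot x (A *m y) <=
    mu ^+ 2 / 2 * ((norm2 x ^+ 2 + n%:R / 4) * (norm2 y ^+ 2 + n%:R / 4)) +
    (norm2 x ^+ 2 + n%:R / 4) / 2 + (norm2 y ^+ 2 + n%:R / 4) / 2 + C.
Proof.
move=> xN yN h; set X := norm2 x ^+ 2 + _; set Y := norm2 y ^+ 2 + _.
have X0 : 0 <= X by rewrite addr_ge0 ?sqr_ge0// divr_ge0// ler0n.
have m20 : 0 <= mu ^+ 2 / 2 by rewrite divr_ge0// sqr_ge0.
have h1 m' : mu * dot x (A *m lattice_vec m') <=
    mu ^+ 2 / 2 * (X * norm2 (lattice_vec m') ^+ 2) + X / 2 + norm2 (lattice_vec m') ^+ 2 / 2 + C.
  set a := norm2 (lattice_vec m') ^+ 2.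
  have a0 : 0 <= a by exact: sqr_ge0.
  have := @round_vec (mu *: (A *m lattice_vec m')) x (a / 2 + C) (mu ^+ 2 / 2 * a + 1 / 2).
  rewrite dotZl (dotC _ x) => hh; apply: le_trans (hh _ xN _) _.
  - by apply: addr_ge0; [exact: mulr_ge0|lra].
  - by move=> m; rewrite dotZl dotC; have := h m m'; rewrite -/a; lra.
  - by rewrite -/X; lra.
have := @round_vec (mu *: (A^T *m x)) y (X / 2 + C) (mu ^+ 2 / 2 * X + 1 / 2).
rewrite dotZl -dot_mulmx => hh; apply: le_trans (hh _ yN _) _.
- by apply: addr_ge0; [exact: mulr_ge0|lra].
- by move=> m; rewrite dotZl -dot_mulmx; have := h1 m; lra.
- by rewrite -/Y; lra.
Qed.

Lemma lattice_vec_weight :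
  \sum_m expR (- (norm2 (lattice_vec m) ^+ 2 / 2)) <= expR n%:R.
Proof.
have -> : expR n%:R = \prod_(i < n) expR 1 :> R.
  by rewrite prodr_const card_ord -expRM_natl mulr1.
apply: le_trans (_ : \prod_(i < n) \sum_(j : lattice_pt) expR (- (lattice_val j ^+ 2 / 2)) <= _).
  rewrite bigA_distr_bigA/=; apply: ler_sum => m _.
  rewrite norm2_sum_sqr mulr_suml -sumrN expR_sum.
  by apply: ler_prod => i _; rewrite expR_ge0 mxE/=.
apply: ler_prod => i _; rewrite lattice_weight andbT.
by apply: sumr_ge0 => j _; exact: expR_ge0.
Qed.

End Lattice.

(** * The operator norm of a Gaussian matrix *)

Section OperatorNorm.
Context d (Omega : measurableType d) (R : realType) (P : probability Omega R).
Variables (n : nat) (G : 'I_n -> 'I_n -> {RV P >-> R}).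
Hypotheses (n0 : (0 < n)%N) (hG : standard_gaussian_mx G).

(** Unit vectors are rounded at scale 1 / sqrt n.  The variance of the bilinear
    form at lattice points m, m' is mu^2 |m|^2 |m'|^2, half of which is the
    first term of the threshold b; the rest of b makes the failure
    probabilities sum to at most exp (- L).  Rounding multiplies squared norms
    by 5/4, whence 25/32 = (5/4)^2 / 2 and 13/4 = 5/4 + 2. *)
Lemma gaussian_operator_norm (lam L : R) : exists A : set Omega,
  [/\ measurable A, ((1 - expR (- L))%:E <= P A)%E &
   forall w, A w -> forall x, lam * norm2 (rv_mx G w *m x) <=
     (25 / 32 * lam ^+ 2 + 13 / 4 * n%:R + L) * norm2 x].
Proof.
pose K := {ffun 'I_n -> lattice_pt n.+1}.
pose z (m : K) : 'cV[R]_n := lattice_vec R m.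
pose mu := lam / n%:R.
pose b (k : K * K) := mu ^+ 2 / 2 * (norm2 (z k.1) ^+ 2 * norm2 (z k.2) ^+ 2) +
  norm2 (z k.1) ^+ 2 / 2 + norm2 (z k.2) ^+ 2 / 2 + (2 * n%:R + L).
pose a (k : K * K) (ij : 'I_n * 'I_n) := mu * (z k.1 ij.1 0 * z k.2 ij.2 0).
have aE k : \sum_ij a k ij ^+ 2 / 2 = mu ^+ 2 / 2 * (norm2 (z k.1) ^+ 2 * norm2 (z k.2) ^+ 2).
  rewrite !norm2_sum_sqr big_distrlr/= pair_bigA/= mulr_sumr.
  by apply: eq_bigr => ij _; rewrite /a !exprMn; ring.
have [indep law] := hG.
have hsum : \sum_k expR (\sum_ij a k ij ^+ 2 / 2 - b k) <= expR (- L).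
  under eq_bigr => k _.
    rewrite aE (_ : _ - b k = - (norm2 (z k.1) ^+ 2 / 2) +
      - (norm2 (z k.2) ^+ 2 / 2) + (- (2 * n%:R) - L)); last by rewrite /b; ring.
    rewrite !expRD; over.
  rewrite -mulr_suml.
  have -> : \sum_(k : K * K) expR (- (norm2 (z k.1) ^+ 2 / 2)) *
     expR (- (norm2 (z k.2) ^+ 2 / 2)) =
     (\sum_m expR (- (norm2 (z m) ^+ 2 / 2))) ^+ 2.
    by rewrite expr2 big_distrlr/= pair_bigA.
  have h := @lattice_vec_weight R n.+1 n.
  have h0 : 0 <= \sum_m expR (- (norm2 (z m) ^+ 2 / 2)) by apply: sumr_ge0 => m _; exact: expR_ge0.
  rewrite mulrA; apply: le_trans (_ : 1 * expR (- L) <= _); last by rewrite mul1r.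
  rewrite ler_wpM2r ?expR_ge0//.
  apply: le_trans (_ : expR n%:R ^+ 2 * expR (- (2 * n%:R)) <= _).
    rewrite ler_wpM2r ?expR_ge0// ler_pXn2r ?nnegrE ?expR_ge0//.
  by rewrite -expRM_natl -expRD subrr expR0.
have [A [mA PA hA]] := gaussian_forms_tail indep (fun ij => law ij.1 ij.2) hsum.
exists A; split => // w Aw.
have nR : 0 < n%:R :> R by rewrite ltr0n.
have unit_bound (u v : 'cV[R]_n) : norm2 u = 1 -> norm2 v = 1 ->
    lam * dot u (rv_mx G w *m v) <= 25 / 32 * lam ^+ 2 + 13 / 4 * n%:R + L.
  move=> u1 v1; set s := Num.sqrt n%:R : R.
  have s2 : s ^+ 2 = n%:R by rewrite sqr_sqrtr ?ler0n.
  have box (x : 'cV[R]_n) : norm2 x = 1 -> forall i, `|(s *: x) i 0| + 1 <= n.+1%:R.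
    move=> x1 i; rewrite mxE -natr1 lerD2r normrM ger0_norm ?sqrtr_ge0//.
    have xi : `|x i 0| <= 1.
      rewrite -(@ler_pXn2r _ 2) ?nnegrE// expr1n -[leRHS](expr1n _ 2) -x1 norm2_sum_sqr.
      by rewrite (bigD1 i)//= real_normK ?num_real// lerDl sumr_ge0// => j _; rewrite sqr_ge0.
    have s1 : 1 <= s by rewrite -sqrtr1 ler_wsqrtr// ler1n.
    have s0 : 0 <= s by exact: sqrtr_ge0.
    rewrite -s2 expr2; apply: le_trans (_ : s * 1 <= _); first by rewrite ler_wpM2l.
    by rewrite ler_wpM2l.
  have ns (x : 'cV[R]_n) : norm2 x = 1 -> norm2 (s *: x) ^+ 2 = n%:R.
    by move=> x1; rewrite norm2Z x1 mulr1 ger0_norm ?sqrtr_ge0.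
  have := @round_bilinear R n.+1 n (rv_mx G w) mu (2 * n%:R + L) (s *: u) (s *: v) (box _ u1) (box _ v1).
  rewrite /= !ns// => hh.
  have {hh} := hh _; rewrite -scalemxAr dotZl dotZr => hh.
  have -> : lam * dot u (rv_mx G w *m v) = mu * (s * (s * dot u (rv_mx G w *m v))).
    by rewrite [s * (s * _)]mulrA -expr2 s2 /mu; field; rewrite gt_eqF.
  apply: le_trans (hh _) _; last first.
    have -> : mu ^+ 2 / 2 * ((n%:R + n%:R / 4) * (n%:R + n%:R / 4)) = 25 / 32 * lam ^+ 2.
      by rewrite /mu; field; rewrite gt_eqF.
    lra.
  move=> m m'; have := hA _ Aw (m, m'); rewrite /b/= -/(z m) -/(z m') addrA.
  apply: le_trans; rewrite le_eqVlt; apply/orP; left; apply/eqP.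
  rewrite dotE mulr_sumr -(pair_bigA _ (fun i j => a (m, m') (i, j) * G i j w))/=.
  apply: eq_bigr => i _; rewrite [X in _ * (_ * X)]mxE !mulr_sumr; apply: eq_bigr => j _.
  by rewrite /a/= /rv_mx [X in _ * (_ * (X * _))]mxE; ring.
move=> x; set y := rv_mx G w *m x.
have [x0|x0] := eqVneq x 0; first by rewrite /y x0 mulmx0 norm20 !mulr0.
have nx : 0 < norm2 x by rewrite norm2_gt0.
have normed (v : 'cV[R]_n) : v != 0 -> norm2 ((norm2 v)^-1 *: v) = 1.
  move=> v0; rewrite norm2Z ger0_norm ?invr_ge0 ?norm2_ge0// mulVf//.
  by rewrite norm2_eq0.
rewrite -ler_pdivrMr//.
have [y0|y0] := eqVneq y 0.
  have := unit_bound _ _ (normed _ x0) (normed _ x0).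
  by rewrite -scalemxAr -/y y0 scaler0 dotv0 norm20 !mulr0 mul0r.
have := unit_bound _ _ (normed _ y0) (normed _ x0).
apply: le_trans; rewrite -scalemxAr -/y dotZl dotZr -norm2_sqr.
rewrite le_eqVlt; apply/orP; left; apply/eqP; field.
by rewrite gt_eqF//= norm2_eq0.
Qed.
End OperatorNorm.

(** * The perturbation bound *)

Section Assembly.
Variable R : realType.

Lemma mxrank_injective m p (A : 'M[R]_(m, p)) :
  (forall x : 'cV_p, A *m x = 0 -> x = 0) -> \rank A = p.
Proof.
move=> Ainj; rewrite -mxrank_tr; apply/eqP; change (row_free A^T).
rewrite -kermx_eq0; apply/rowV0P => v /sub_kermxP vA.
apply: trmx_inj; rewrite trmx0; apply: Ainj.
by apply: trmx_inj; rewrite trmx_mul trmxK vA trmx0.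
Qed.

Lemma log_volE m p (B : 'M[R]_(m, p)) : 0 < vol B -> log_vol B = (ln (vol B))%:E.
Proof. exact: lne_EFin. Qed.

Lemma log_vol_le m p q (A : 'M[R]_(m, p)) (B : 'M[R]_(m, q)) :
  (log_vol A <= log_vol B)%E -> vol A <= vol B.
Proof.
by rewrite /log_vol lee_lne ?lee_fin// in_itv/= leey lee_fin vol_ge0.
Qed.

Lemma ln4_ge : 9 / 8 <= ln 4 :> R.
Proof.
rewrite -ler_expR lnK ?posrE// -[leLHS]invrK -expRN invf_ple ?posrE ?expR_gt0//.
have -> : - (9 / 8) = 4%:R * - (9 / 32) :> R by lra.
rewrite expRM_natl; apply: le_trans (_ : (23 / 32) ^+ 4 <= _); first by lra.
rewrite ler_pXn2r ?nnegrE ?expR_ge0//; apply: le_trans (expR_ge1Dx _); lra.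
Qed.

(** With s = sqrt n these two turn the bound at lam = 2 s + t into one on the
    operator norm.  For n <= 4 the cross term 4 s t, with t not small, absorbs
    part of the term in s^2. *)
Lemma norm_constant_le (s t L : R) : 0 <= s -> 0 <= t -> t ^+ 2 = 2 * L ->
  25 / 32 * (2 * s + t) ^+ 2 + 13 / 4 * s ^+ 2 + L <= 8 / 5 * (2 * s + t) ^+ 2.
Proof. by move=> s0 t1 tL; nra. Qed.

Lemma norm_constant_le_small (s t L : R) : 0 <= s -> s <= 2 -> 3 / 2 <= t ->
  t ^+ 2 = 2 * L ->
  25 / 32 * (2 * s + t) ^+ 2 + 13 / 4 * s ^+ 2 + L <= 13 / 10 * (2 * s + t) ^+ 2.
Proof.
move=> s0 s2 t1 tL; have : 117 / 100 * s <= 207 / 100 * t by lra.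
move=> /(ler_wpM2l s0); nra.
Qed.

End Assembly.

Theorem theorem4p4 (R : realType) (n : nat) (X : 'M[R]_n) (k : nat)
    (hk : (0 < k <= \rank X)%N)
    (Sopt : {set 'I_n}) (hSopt : maximizes_log_vol X k Sopt)
    (d : measure_display) (Omega : measurableType d) (P : probability Omega R)
    (G : 'I_n -> 'I_n -> {RV P >-> R}) (hG : standard_gaussian_mx G)
    (delta eps : R) (hdelta : 0 < delta < 1) :
  let Xopt := col_submx X Sopt in
  let Z := fun w : Omega => X + eps *: rv_mx G w in
  let Delta1 := delta * eps / (47 / 10 * Num.sqrt n%:R) in
  let Delta2 := 2 * Num.sqrt n%:R + Num.sqrt (2 * ln (4 / delta)) in
  0 < eps < Num.min
    (sigma k Xopt / (2 * Delta2))
    (sigma k X / (Delta2 * (1 + 2 ^+ k.+1 * Num.sqrt (n - k)%:R))) ->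
  exists A : set Omega,
    [/\ measurable A,
        ((1 - delta)%:E <= P A)%E &
        forall w, A w ->
          (k <= \rank (Z w))%N /\
          forall S : {set 'I_n}, bg_output (Z w) k S ->
            let eta1 := eps * Delta2 / sigma k (col_submx (Z w) S) in
            let eta2 := eps * Delta2 / sigma k Xopt in
            [/\ (0 <= log_vol Xopt - log_vol (col_submx X S))%E,
                (log_vol Xopt - log_vol (col_submx X S) <=
                   (expR 1)^-1%:E * log_vol (Delta1^-1 *: Xopt)
                   + (k%:R * (2 * eta2 + eta1))%:E)%E,
                (k < n)%N -> eta1 <= 1 / 2 &
                eta2 <= 1 / 2]].
Proof.
move=> Xopt Z Delta1 Delta2 /andP[eps0]; rewrite lt_min => /andP[heps1 heps2].
have [k0 kX] := andP hk; have kn : (k <= n)%N by exact: leq_trans kX (rank_leq_row _).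
have n0 : (0 < n)%N := leq_trans k0 kn.
have [d0 d1] := andP hdelta; have [cS Smax'] := hSopt.
have Smax (S' : {set 'I_n}) : #|S'| = k -> vol (col_submx X S') <= vol Xopt.
  by move=> /Smax'; exact: log_vol_le.
set s := Num.sqrt n%:R : R; set t := Num.sqrt (2 * ln (4 / delta)) : R.
have D2E : Delta2 = 2 * s + t by [].
have s0 : 0 <= s by exact: sqrtr_ge0.
have s1 : 1 <= s by rewrite -sqrtr1 ler_wsqrtr// ler1n.
have s2 : s ^+ 2 = n%:R by rewrite sqr_sqrtr ?ler0n.
have L4 : 9 / 8 <= ln (4 / delta).
  apply: le_trans (ln4_ge R) _; rewrite ler_ln ?posrE ?divr_gt0//.
  by rewrite ler_pdivlMr// ler_piMr// ltW.
have t2 : t ^+ 2 = 2 * ln (4 / delta) by rewrite sqr_sqrtr//; lra.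
have t0 : 0 <= t by exact: sqrtr_ge0.
have t1 : 3 / 2 <= t by rewrite leNgt; apply/negP => h; nra.
have D2ge : 2 * s + 3 / 2 <= Delta2 by rewrite D2E; lra.
have D20 : 0 < Delta2 by lra.
have [A [mA PA hA]] := gaussian_operator_norm n0 hG Delta2 (ln (4 / delta)).
exists A; split => //.
  apply: le_trans PA; rewrite lee_fin lerD2l lerN2 expRN lnK ?posrE ?divr_gt0//.
  by rewrite invf_div ler_pdivrMr// ler_peMr ?ltW//; lra.
move=> w Aw; set E := eps *: rv_mx G w.
pose D := eps * Delta2.
have D0 : 0 < D by exact: mulr_gt0.
have normE c : 25 / 32 * Delta2 ^+ 2 + 13 / 4 * n%:R + ln (4 / delta) <= c * Delta2 ^+ 2 ->
    forall x, norm2 (E *m x) <= c * D * norm2 x.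
  move=> hc x; rewrite /E -scalemxAl norm2Z gtr0_norm//.
  have h := hA _ Aw x; have nx := norm2_ge0 x.
  rewrite -(ler_pM2l D20).
  have : (25 / 32 * Delta2 ^+ 2 + 13 / 4 * n%:R + ln (4 / delta)) * norm2 x <= c * Delta2 ^+ 2 * norm2 x.
    by rewrite ler_wpM2r.
  move=> h2; have := ler_wpM2l (ltW eps0) (le_trans h h2).
  by rewrite /D; lra.
have hE : forall x, norm2 (E *m x) <= 8 / 5 * D * norm2 x.
  by apply: normE; rewrite -s2; exact: norm_constant_le.
have heps1' : 2 * D < sigma k Xopt.
  by move: heps1; rewrite ltr_pdivlMr ?mulr_gt0// /D mulrCA.
have heps2' : D * (1 + 2 ^+ k.+1 * Num.sqrt (n - k)%:R) < sigma k X.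
  have f0 : 0 < 1 + 2 ^+ k.+1 * Num.sqrt (n - k)%:R :> R.
    by rewrite ltr_wpDr// mulr_ge0 ?exprn_ge0 ?sqrtr_ge0.
  by move: heps2; rewrite ltr_pdivlMr ?mulr_gt0// mulrA.
have optE x : 2 * D * norm2 x <= norm2 (Xopt *m x).
  apply: le_trans (norm2_ge_singular_value_last _ _).
  by rewrite ler_wpM2r ?norm2_ge0// ltW// [X in X.-1]cS.
have vXopt : (2 * D) ^+ k <= vol Xopt.
  by rewrite -[X in _ ^+ X]cS; apply: vol_ge => //; lra.
have D0k : 0 < 2 * D by lra.
have u0 : 0 < vol Xopt by apply: lt_le_trans vXopt; rewrite exprn_gt0.
have D10 : 0 < Delta1 by rewrite /Delta1 -/s divr_gt0 ?mulr_gt0//; lra.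
have D1E : 47 / 10 * s * Delta1 = delta * eps.
  by rewrite /Delta1 -/s; field; rewrite gt_eqF//; lra.
have hD : 47 / 10 * s * (2 * s + 3 / 2) * Delta1 <= D.
  rewrite mulrAC D1E /D; apply: le_trans (_ : 1 * eps * Delta2 <= _); last by rewrite mul1r.
  apply: ler_pM => //; [by rewrite mulr_ge0// ltW|lra|].
  by rewrite ler_pM2r// ltW.
have D1D : Delta1 <= 2 * D.
  have h1 : 0 <= (47 / 10 * s * (2 * s + 3 / 2) - 1) * Delta1 by apply: mulr_ge0; [nra|exact: ltW].
  by lra.
have eta2_le : eps * Delta2 / sigma k Xopt <= 1 / 2.
  by rewrite ler_pdivrMr -/D; lra.
have eta2_ge0 : 0 <= eps * Delta2 / sigma k Xopt.
  by rewrite divr_ge0 ?singular_values_ge0// ltW.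
have volZ1 : vol (Delta1^-1 *: Xopt) = Delta1 ^- k * vol Xopt.
  by rewrite volZ ?invr_ge0 ?ltW// exprVn [X in _ ^- X]cS.
have vs0 : 0 < vol (Delta1^-1 *: Xopt) by rewrite volZ1 mulr_gt0// invr_gt0 exprn_gt0.
have lvs : ln (vol (Delta1^-1 *: Xopt)) = ln (vol Xopt) - k%:R * ln Delta1.
  rewrite volZ1 lnM ?posrE ?invr_gt0 ?exprn_gt0// lnV ?posrE ?exprn_gt0// lnXn//.
  by rewrite addrC mulr_natl.
split.
  (* The optimal columns stay independent under a perturbation of norm less than
     their least singular value. *)
  have Zinj (x : 'cV[R]_#|Sopt|) : col_submx (Z w) Sopt *m x = 0 -> x = 0.
    move=> Zx; apply/eqP; rewrite -norm2_eq0 eq_le norm2_ge0 andbT.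
    have Xx : Xopt *m x = - (E *m (sel_mx R (@enum_val _ (mem Sopt)) *m x)).
      move: Zx; rewrite /Z -/E /Xopt /col_submx -!mul_sel_mx mulmxDl mulmxDl.
      by rewrite -!mulmxA => /eqP; rewrite addr_eq0 => /eqP.
    have := optE x; rewrite Xx norm2N => h.
    have := hE (sel_mx R (@enum_val _ (mem Sopt)) *m x).
    rewrite norm2_sel_mx; last exact: enum_val_inj.
    move=> h2; have := le_trans h h2; rewrite -subr_ge0 -mulrBl.
    by rewrite nmulr_rge0//; lra.
  have := mxrank_injective Zinj; rewrite [RHS]cS => <-.
  by rewrite /col_submx -mul_sel_mx; exact: mxrankM_maxl.
move=> S hS; rewrite /Z -/E in hS *.
have cSel : #|S| = k.
  have [T [Q b]] := hS; have [f [M [ys H]]] := bg_state_pivoting b.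
  exact: piv_card H.
set eta1 := eps * Delta2 / sigma k (col_submx (X + E) S).
set eta2 := eps * Delta2 / sigma k Xopt in eta2_le eta2_ge0 *.
have eta1_ge0 : 0 <= eta1 by rewrite divr_ge0 ?singular_values_ge0// ltW.
have eta_ge0 : 0 <= k%:R * (2 * eta2 + eta1).
  by rewrite mulr_ge0 ?ler0n// addr_ge0// mulr_ge0.
suff [v0 gap] : 0 < vol (col_submx X S) /\
    ln (vol Xopt) - ln (vol (col_submx X S)) <=
      (expR 1)^-1 * (ln (vol Xopt) - k%:R * ln Delta1).
  split => //.
  - rewrite !log_volE// -EFinB lee_fin subr_ge0 ler_ln ?posrE//.
    exact: Smax.
  - rewrite !log_volE// -EFinB -EFinM -EFinD lee_fin lvs.
    by rewrite (le_trans gap)// lerDl.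
  - move=> ltkn; rewrite /eta1 -/D.
    have h : 7 / 3 * D <= sigma k (col_submx (X + E) S).
      apply: singular_value_ge; first by rewrite [X in (_ < X)%N]cSel prednK.
      exact: (selected_well_conditioned k0 ltkn D0 heps2' hE (lexx _) hS).
    by rewrite ler_pdivrMr; lra.
(* For k = n there is a single submatrix, and nothing is lost. *)
have [ltkn|nk] := ltnP k n; last first.
  have kE : k = n by apply/eqP; rewrite eqn_leq kn nk.
  have ST (S' : {set 'I_n}) : #|S'| = k -> S' = [set: 'I_n]%SET.
    by move=> cS'; apply/eqP; rewrite eqEcard finset.subsetT cardsT card_ord cS' kE leqnn.
  rewrite (ST _ cSel) -(ST _ cS) -/Xopt; split => //; rewrite subrr.
  rewrite mulr_ge0 ?invr_ge0 ?expR_ge0// -lvs ln_ge0// volZ1.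
  rewrite mulrC ler_pdivlMr ?exprn_gt0// mul1r; apply: le_trans vXopt.
  by apply: lerXn2r; rewrite ?nnegrE//; exact: ltW.
split; first exact: (selected_vol_gt0 k0 ltkn D0 heps2' hE (lexx _) hS).
have [q q1 [h1 h2]] : exists2 q : R, 1 <= q &
    vol Xopt <= q ^+ k * vol (col_submx X S) /\ (q ^+ 3 * Delta1) ^+ k <= vol Xopt.
  have [k1|k1] := ltnP 1 k.
    exact: (vol_ratio_large k0 ltkn cS Smax D0 D10 heps2' hD hE (lexx _) hS).
  have {}k1 : k = 1%N by apply/eqP; rewrite eqn_leq k1 k0.
  have [n4|n4] := leqP n 4.
    have hE' : forall x, norm2 (E *m x) <= 13 / 10 * D * norm2 x.
      apply: normE; rewrite -s2; apply: norm_constant_le_small => //.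
      by rewrite -(@ler_pXn2r _ 2) ?nnegrE// s2 -natrX ler_nat.
    apply: (vol_ratio1 k0 ltkn cS Smax D0 D10 heps2' hD hE' _ hS k1) => //.
    by lra.
  apply: (vol_ratio1 k0 ltkn cS Smax D0 D10 heps2' hD hE (lexx _) hS k1).
  by rewrite leqNgt n4.
apply: log_ratio_le h1 h2 => //.
exact: (selected_vol_gt0 k0 ltkn D0 heps2' hE (lexx _) hS).
Qed.
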